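(* Let $\widetilde{\mathrm{SL}}_2(\mathbb{R})\subseteq \widetilde{\mathrm{Homeo}}_+(\mathbb{S}^1)$, the translations $\mathcal{T}_n$, the canonical liftings $\widetilde{\rho}_\vartheta,\widetilde{\mathrm{a}}_\lambda,\widetilde{\mathrm{u}}_{x}$ and the function $\ell^\sharp$ be as defined in the context, and write $[\alpha]$ for the conjugacy class of $\alpha$ in $\widetilde{\mathrm{SL}}_2(\mathbb{R})$. Then the following is a complete list, without repetition, of the conjugacy classes of $\widetilde{\mathrm{SL}}_2(\mathbb{R})$, where $\vartheta$ ranges over $(0,\pi)$, $\lambda$ over $\mathbb{R}_{>1}$ and $n$ over $\mathbb{Z}_{\geq 1}$, and different listed forms or different values of the parameters give different conjugacy classes. Moreover, $\ell^\sharp$ takes on each class the indicated value: \begin{itemize} \item $[\mathrm{id}_{\mathbb{R}}]$, with $\ell^\sharp=[0]$; \item $[\widetilde{\mathrm{u}}_1]$, $[\widetilde{\mathrm{u}}_{-1}]$, $[\widetilde{\mathrm{a}}_\lambda]$, $[\widetilde{\rho}_\vartheta]$, $[\mathcal{T}_{-1}\,\widetilde{\rho}_\vartheta]$, with $\ell^\sharp=[(0,1)]$; \item $[\mathcal{T}_n]$, $[\mathcal{T}_{-n}]$, $[\mathcal{T}_n\,\widetilde{\mathrm{u}}_1]$, $[\mathcal{T}_{-n}\,\widetilde{\mathrm{u}}_{-1}]$, with $\ell^\sharp=[n]$; \item $[\mathcal{T}_{-n}\,\widetilde{\mathrm{u}}_1]$, $[\mathcal{T}_n\,\widetilde{\mathrm{u}}_{-1}]$,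 $[\mathcal{T}_n\,\widetilde{\mathrm{a}}_\lambda]$, $[\mathcal{T}_{-n}\,\widetilde{\mathrm{a}}_\lambda]$, $[\mathcal{T}_n\,\widetilde{\rho}_\vartheta]$, $[\mathcal{T}_{-1-n}\,\widetilde{\rho}_\vartheta]$, with $\ell^\sharp=[(n,n+1)]$. \end{itemize}
   Context: Let $\mathbb{S}^1=\mathbb{R}/\mathbb{Z}$, with $\overline{x}$ the class of $x\in\mathbb{R}$, and let $\mathrm{Homeo}_+(\mathbb{S}^1)$ be the group of orientation-preserving self-homeomorphisms of $\mathbb{S}^1$. Let $$\widetilde{\mathrm{Homeo}}_+(\mathbb{S}^1)=\{\alpha\in \mathrm{Homeo}(\mathbb{R}) : \alpha(x+1)=\alpha(x)+1 \text{ for all } x\in\mathbb{R}\},$$ a group under composition. Each $\alpha$ in it induces $\overline{\alpha}\in\mathrm{Homeo}_+(\mathbb{S}^1)$ by $\overline{\alpha}(\overline{x})=\overline{\alpha(x)}$. For $u\in\mathbb{R}$, $\mathcal{T}_u(x)=x+u$ is the translation by $u$. The kernel of $\alpha\mapsto\overline{\alpha}$ is $\{\mathcal{T}_n\}_{n\in\mathbb{Z}}$. The group $\mathrm{PSL}_2(\mathbb{R})$ acts faithfully and continuously on the real projective line (the set of lines through $0$ in $\mathbb{R}^2$) by its linear action, and the projective line is identified with $\mathbb{R}/\mathbb{Z}$ by letting $\overline{x}$ correspond to the line spanned by $(\cos \pi x,\sin\pi x)^{\mathrm{T}}$. This gives an embedding $\mathrm{PSL}_2(\mathbb{R})\hookrightarrow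 \mathrm{Homeo}_+(\mathbb{S}^1)$, through which elements of $\mathrm{PSL}_2(\mathbb{R})$ are regarded as homeomorphisms of $\mathbb{S}^1$. The group $\widetilde{\mathrm{SL}}_2(\mathbb{R})$ is the preimage of $\mathrm{PSL}_2(\mathbb{R})$ under $\widetilde{\mathrm{Homeo}}_+(\mathbb{S}^1)\to\mathrm{Homeo}_+(\mathbb{S}^1)$, $\alpha\mapsto\overline{\alpha}$. Canonical lifting: for $\varphi\in\mathrm{Homeo}_+(\mathbb{S}^1)$, $\widetilde{\varphi}$ is the unique element of $\widetilde{\mathrm{Homeo}}_+(\mathbb{S}^1)$ with $\overline{\widetilde{\varphi}}=\varphi$ and $\widetilde{\varphi}(0)\in[0,1)$. Elements of $\mathrm{PSL}_2(\mathbb{R})$ (classes of matrices up to sign): $$\rho_\vartheta=\begin{bmatrix}\cos\vartheta&-\sin\vartheta\\ \sin\vartheta&\cos\vartheta\end{bmatrix}\ (0\le\vartheta<\pi),\quad \mathrm{a}_\lambda=\begin{bmatrix}\lambda&0\\0&1/\lambda\end{bmatrix}\ (\lambda>0),\quad \mathrm{u}_x=\begin{bmatrix}1&x\\0&1\end{bmatrix}\ (x\in\mathbb{R}),$$ and $\widetilde{\rho}_\vartheta,\widetilde{\mathrm{a}}_\lambda,\widetilde{\mathrm{u}}_x$ denote their canonical liftings. Length: $\ell(\alpha)=\sup_{t\in[0,1]}|\alpha(t)-t|\in\mathbb{R}_{\ge0}$ for $\alpha\in\widetilde{\mathrm{Homeo}}_+(\mathbb{S}^1)$. Let $\mathbb{R}^\sharp$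 be the quotient of $\mathbb{R}$ by the equivalence relation $x\cong y$ iff either $x=y\in\mathbb{Z}$ or $x,y\in(k,k+1)$ for some $k\in\mathbb{Z}$; its elements are denoted $[k]$ (class of the integer $k$) and $[(k,k+1)]$ (class of any element of the open interval $(k,k+1)$). Then $\ell^\sharp(\alpha)\in\mathbb{R}^\sharp$ is the class of $\ell(\alpha)$. The function $\ell^\sharp$ is constant on conjugacy classes. *)

(* Defs.v *)
From HB Require Import structures.
From mathcomp Require Import all_boot all_order all_algebra.
From mathcomp Require Import all_classical all_reals all_analysis.

Set Implicit Arguments.
Unset Strict Implicit.
Unset Printing Implicit Defensive.

Import Order.TTheory GRing.Theory Num.Theory.
Import numFieldNormedType.Exports.

Local Open Scope classical_set_scope.
Local Open Scope ring_scope.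
Local Open Scope quotient_scope.

(* The two-sided continuous inverse is part of the data; since it is
   determined by the function, equality is extensional ([liftHomeoP]). *)
Record liftHomeo (R : realType) := LiftHomeo {
  lh_fun :> R -> R;
  lh_inv : R -> R;
  lh_funK : cancel lh_fun lh_inv;
  lh_invK : cancel lh_inv lh_fun;
  lh_fun_continuous : continuous lh_fun;
  lh_inv_continuous : continuous lh_inv;
  lh_funD1 : forall x, lh_fun (x + 1) = lh_fun x + 1
}.

Section LiftHomeoGroup.
Variable R : realType.
Implicit Types a b c : liftHomeo R.

Lemma liftHomeoP a b : a =1 b -> a = b.
Proof.
case: a b => [f f' fK f'K fc f'c fD] [g g' gK g'K gc g'c gD] /= fg.
have efg : f = g by apply/funext.
subst g; have e' : f' = g' by apply/funext => x; rewrite -[x in LHS]g'K fK.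
subst g'; congr LiftHomeo; exact: Prop_irrelevance.
Qed.

HB.instance Definition _ := gen_eqMixin (liftHomeo R).
HB.instance Definition _ := gen_choiceMixin (liftHomeo R).

Lemma lh_invD1 a x : lh_inv a (x + 1) = lh_inv a x + 1.
Proof. by rewrite -{1}(lh_invK a x) -lh_funD1 lh_funK. Qed.

Definition lh_one : liftHomeo R.
Proof.
by apply: (@LiftHomeo R id id) => // x; exact: cvg_id.
Defined.

Definition lh_opp a : liftHomeo R :=
  LiftHomeo (lh_invK a) (lh_funK a)
    (@lh_inv_continuous R a) (@lh_fun_continuous R a) (lh_invD1 a).

Definition lh_mul a b : liftHomeo R.
Proof.
apply: (@LiftHomeo R (a \o b) (lh_inv b \o lh_inv a)).
- exact: can_comp (lh_funK a) (lh_funK b).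
- exact: can_comp (lh_invK b) (lh_invK a).
- move=> x; apply: continuous_comp; exact: lh_fun_continuous.
- move=> x; apply: continuous_comp; exact: lh_inv_continuous.
- by move=> x /=; rewrite !lh_funD1.
Defined.

Fact lh_mulA : associative lh_mul.
Proof. by move=> a b c; exact: liftHomeoP. Qed.

Fact lh_mul1 : left_id lh_one lh_mul.
Proof. by move=> a; exact: liftHomeoP. Qed.

Fact lh_mulr1 : right_id lh_one lh_mul.
Proof. by move=> a; exact: liftHomeoP. Qed.

Fact lh_mulV : left_inverse lh_one lh_opp lh_mul.
Proof. by move=> a; apply: liftHomeoP => x /=; rewrite lh_funK. Qed.

Fact lh_mulrV : right_inverse lh_one lh_opp lh_mul.
Proof. by move=> a; apply: liftHomeoP => x /=; rewrite lh_invK. Qed.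

HB.instance Definition _ := isGroup.Build (liftHomeo R)
  lh_mulA lh_mul1 lh_mulr1 lh_mulV lh_mulrV.

Lemma lh_funDz a x (k : int) : a (x + k%:~R) = a x + k%:~R.
Proof.
have Hn y n : a (y + n%:R) = a y + n%:R.
  elim: n => [|n IHn]; first by rewrite !addr0.
  by rewrite -natr1 !addrA lh_funD1 IHn.
case: k => n; first exact: Hn.
rewrite NegzE mulrNz; apply: (addIr (n.+1%:R)).
by rewrite -Hn -!addrA addNr !addr0.
Qed.

Definition transl (u : R) : liftHomeo R.
Proof.
apply: (@LiftHomeo R (fun x => x + u) (fun x => x - u)).
- exact: addrK.
- exact: subrK.
- by move=> x; apply: cvgD; [exact: cvg_id|exact: cvg_cst].
- by move=> x; apply: cvgB; [exact: cvg_id|exact: cvg_cst].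
- by move=> x; rewrite addrAC.
Defined.

End LiftHomeoGroup.

Section Circle.
Variable R : realType.
Implicit Types (x y : R) (a : liftHomeo R).

Definition circle_rel x y : bool := (x - y) \is a Num.int.

Fact circle_rel_refl : reflexive circle_rel.
Proof. by move=> x; rewrite /circle_rel subrr rpred0. Qed.

Fact circle_rel_sym : symmetric circle_rel.
Proof. by move=> x y; rewrite /circle_rel -rpredN opprB. Qed.

Fact circle_rel_trans : transitive circle_rel.
Proof.
move=> y x z xy yz; have -> : circle_rel x z = ((x - y) + (y - z) \is a Num.int).
  by rewrite addrA subrK.
exact: rpredD.
Qed.

Canonical circle_equiv :=
  EquivRel circle_rel circle_rel_refl circle_rel_sym circle_rel_trans.

Definition circle := {eq_quot circle_equiv}.

HB.instance Definition _ := Choice.on circle.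
HB.instance Definition _ := EqQuotient.on circle.

Lemma circle_reprE x : exists k : int, repr (\pi_circle x) = x + k%:~R.
Proof.
have : \pi_circle (repr (\pi_circle x)) == \pi_circle x by rewrite reprK.
rewrite eqmodE /= /circle_rel => /intrP[k hk]; exists k.
by rewrite -hk addrC subrK.
Qed.

Definition circle_map a (p : circle) : circle := \pi_circle (a (repr p)).

Lemma circle_map_pi a x : circle_map a (\pi_circle x) = \pi_circle (a x).
Proof.
rewrite /circle_map; have [k ->] := circle_reprE x.
apply/eqP; rewrite eqmodE /= /circle_rel lh_funDz addrAC subrr add0r.
exact: intr_int.
Qed.

(* An orientation-preserving homeomorphism [phi] of the circle has exactly one
   lift in this set; for any other [phi] there is none and the value is [1]. *)
Definition canonical_lift (phi : circle -> circle) : liftHomeo R :=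
  xget 1%g [set a : liftHomeo R | circle_map a = phi /\ 0 <= a 0 < 1].

End Circle.

Section PSL2.
Variable R : realType.

Definition SL2 := {A : 'M[R]_2 | \det A == 1}.

Definition psl_rel (A B : SL2) : bool := (val A == val B) || (val A == - val B).

Fact psl_rel_refl : reflexive psl_rel.
Proof. by move=> A; rewrite /psl_rel eqxx. Qed.

Fact psl_rel_sym : symmetric psl_rel.
Proof. by move=> A B; rewrite /psl_rel eq_sym -eqr_oppLR [- _ == _]eq_sym. Qed.

Fact psl_rel_trans : transitive psl_rel.
Proof.
move=> B A C /orP[]/eqP eAB /orP[]/eqP eBC; rewrite /psl_rel eAB eBC ?opprK.
all: by rewrite eqxx ?orbT.
Qed.

Canonical psl_equiv := EquivRel psl_rel psl_rel_refl psl_rel_sym psl_rel_trans.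

Definition PSL2 := {eq_quot psl_equiv}.

HB.instance Definition _ := Choice.on PSL2.
HB.instance Definition _ := EqQuotient.on PSL2.

(* Points of the projective line are the subspaces of ['cV[R]_2] of dimension 1;
   the action is defined on all subspaces. *)
Definition psl_act (g : PSL2) (L : {vspace 'cV[R]_2}) : {vspace 'cV[R]_2} :=
  (linfun (mulmx (val (repr g))) @: L)%VS.

Lemma psl_act_pi (A : SL2) (L : {vspace 'cV[R]_2}) :
  psl_act (\pi_PSL2 A) L = (linfun (mulmx (val A)) @: L)%VS.
Proof.
rewrite /psl_act.
have : \pi_PSL2 (repr (\pi_PSL2 A)) == \pi_PSL2 A by rewrite reprK.
rewrite eqmodE /= /psl_rel => /orP[/eqP -> //|/eqP ->].
have sub (B : 'M[R]_2) : (linfun (mulmx (- B)) @: L <= linfun (mulmx B) @: L)%VS.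
  apply/subvP => v /memv_imgP[w wL ->]; rewrite lfunE /= mulNmx -mulmxN.
  by rewrite -[B *m _](lfunE (mulmx B)) memv_img // rpredN.
apply/eqP; rewrite eqEsubv sub /=.
by rewrite -{1}(opprK (val A)) sub.
Qed.

Definition line_dir (x : R) : 'cV[R]_2 :=
  \col_(i < 2) if i == 0 then cos (pi * x) else sin (pi * x).

Definition circle_line (p : circle R) : {vspace 'cV[R]_2} :=
  <[line_dir (repr p)]>%VS.

Lemma circle_line_pi (x : R) : circle_line (\pi_(circle R) x) = <[line_dir x]>%VS.
Proof.
have dirD1 y : line_dir (y + 1) = - line_dir y.
  apply/matrixP => i j; rewrite !mxE mulrDr mulr1 cosDpi sinDpi.
  by case: ifP.
have lineN (v : 'cV[R]_2) : <[- v]>%VS = <[v]>%VS.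
  apply/eqP; rewrite eqEsubv -!memvE memvN memv_line /=.
  by rewrite -(opprK v) memvN opprK memv_line.
have Hn y n : <[line_dir (y + n%:R)]>%VS = <[line_dir y]>%VS.
  elim: n => [|n IHn]; first by rewrite addr0.
  by rewrite -natr1 addrA dirD1 lineN.
rewrite /circle_line; have [[n|n] ->] := circle_reprE x; first exact: Hn.
by rewrite NegzE mulrNz -[LHS](Hn _ n.+1) subrK.
Qed.

(* The identification is a bijection from the circle onto the subspaces of
   dimension 1, so the default value is never used on a line. *)
Definition line_circle (L : {vspace 'cV[R]_2}) : circle R :=
  xget (\pi_(circle R) 0) [set p | circle_line p = L].

Definition psl_circle (g : PSL2) (p : circle R) : circle R :=
  line_circle (psl_act g (circle_line p)).

(* [PSL_2] class of the matrix with rows [(a, b)] and [(c, d)], which is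
   meaningful only when [a * d - b * c = 1]. *)
Definition psl_mx (a b c d : R) : PSL2 :=
  \pi_PSL2 (insubd (exist _ 1%:M (introT eqP (det1 R 2)) : SL2)
    (\matrix_(i < 2, j < 2)
       if i == 0 then (if j == 0 then a else b) else (if j == 0 then c else d))).

Definition psl_rho (th : R) : PSL2 := psl_mx (cos th) (- sin th) (sin th) (cos th).
Definition psl_a (l : R) : PSL2 := psl_mx l 0 0 l^-1.
Definition psl_u (x : R) : PSL2 := psl_mx 1 x 0 1.

End PSL2.

Section Lifts.
Variable R : realType.

Definition SL2t : set (liftHomeo R) :=
  [set a | exists g : PSL2 R, circle_map a = psl_circle g].

Definition rho_lift (th : R) : liftHomeo R :=
  canonical_lift (psl_circle (psl_rho th)).
Definition a_lift (l : R) : liftHomeo R :=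
  canonical_lift (psl_circle (psl_a l)).
Definition u_lift (x : R) : liftHomeo R :=
  canonical_lift (psl_circle (psl_u x)).

Definition SL2t_class (a : liftHomeo R) : set (liftHomeo R) :=
  [set (g * a * g^-1)%g | g in SL2t].

Definition ell (a : liftHomeo R) : R := sup [set `|a t - t| | t in `[0, 1]].

End Lifts.

Section Rsharp.
Variable R : realType.
Implicit Types x y z : R.

Definition sharp_eqv x y : Prop :=
  (x = y /\ exists k : int, x = k%:~R) \/
  (exists k : int, k%:~R < x < (k + 1)%:~R /\ k%:~R < y < (k + 1)%:~R).

Definition sharp_rel x y : bool := `[< sharp_eqv x y >].

Fact sharp_rel_refl : reflexive sharp_rel.
Proof.
move=> x; apply/asboolP; have [xi|xni] := boolP (x \is a Num.int).
  by left; split=> //; apply/intrP.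
right; exists (Num.floor x).
have fx : (Num.floor x)%:~R < x < (Num.floor x + 1)%:~R.
  rewrite lt_neqAle floor_le floorD1_gt !andbT.
  by apply: contra xni => /eqP <-; exact: intr_int.
by split.
Qed.

Fact sharp_rel_sym : symmetric sharp_rel.
Proof.
have imp x y : sharp_rel x y -> sharp_rel y x.
  move=> /asboolP[[-> h]|[k [hx hy]]]; apply/asboolP; first by left.
  by right; exists k.
by move=> x y; apply/idP/idP => /imp.
Qed.

Fact sharp_rel_trans : transitive sharp_rel.
Proof.
move=> y x z /asboolP xy /asboolP yz; apply/asboolP.
case: xy => [[-> //]|[k [hx hy]]].
case: yz => [[<- _]|[m [hy' hz]]]; first by right; exists k.
right; exists k; split=> //.
suff -> : k = m by [].
move: hy hy' => /andP[k1 k2] /andP[m1 m2].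
have km : k < m + 1 by rewrite -(ltr_int R); exact: lt_trans k1 m2.
have mk : m < k + 1 by rewrite -(ltr_int R); exact: lt_trans m1 k2.
by apply/eqP; rewrite eq_le -ltzD1 km -ltzD1 mk.
Qed.

Canonical sharp_equiv :=
  EquivRel sharp_rel sharp_rel_refl sharp_rel_sym sharp_rel_trans.

Definition Rsharp := {eq_quot sharp_equiv}.

HB.instance Definition _ := Choice.on Rsharp.
HB.instance Definition _ := EqQuotient.on Rsharp.

Definition sharp_pt (k : int) : Rsharp := \pi_Rsharp (k%:~R).
Definition sharp_itv (k : int) : Rsharp := \pi_Rsharp (k%:~R + 2^-1).

Lemma sharp_itvE (k : int) x :
  k%:~R < x < (k + 1)%:~R -> \pi_Rsharp x = sharp_itv k.
Proof.
move=> hx; apply/eqP; rewrite eqmodE; apply/asboolP; right; exists k.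
split=> //; rewrite intrD ltrDl invr_gt0 ltr0n /= ltrD2l.
by rewrite invf_lt1 ?ltr0n // ltr1n.
Qed.

Definition ell_sharp (a : liftHomeo R) : Rsharp := \pi_Rsharp (ell a).

End Rsharp.

Section Forms.
Variable R : realType.

Inductive class_form :=
  | F_id
  | F_u | F_uN | F_a of R | F_rho of R | F_TN1rho of R
  | F_T of nat | F_TN of nat | F_Tu of nat | F_TNuN of nat
  | F_TNu of nat | F_TuN of nat | F_Ta of nat & R | F_TNa of nat & R
  | F_Trho of nat & R | F_TN1Nrho of nat & R.

Definition class_form_valid (c : class_form) : bool :=
  match c with
  | F_id | F_u | F_uN => true
  | F_a l => 1 < l
  | F_rho th | F_TN1rho th => 0 < th < pi
  | F_T n | F_TN n | F_Tu n | F_TNuN n | F_TNu n | F_TuN n => (1 <= n)%N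
  | F_Ta n l | F_TNa n l => (1 <= n)%N && (1 < l)
  | F_Trho n th | F_TN1Nrho n th => (1 <= n)%N && (0 < th < pi)
  end.

Local Notation T := (@transl R).

Definition class_form_repr (c : class_form) : liftHomeo R :=
  match c with
  | F_id => 1%g
  | F_u => u_lift 1
  | F_uN => u_lift (-1)
  | F_a l => a_lift l
  | F_rho th => rho_lift th
  | F_TN1rho th => (T (-1) * rho_lift th)%g
  | F_T n => T n%:R
  | F_TN n => T (- n%:R)
  | F_Tu n => (T n%:R * u_lift 1)%g
  | F_TNuN n => (T (- n%:R) * u_lift (-1)%R)%g
  | F_TNu n => (T (- n%:R) * u_lift 1)%g
  | F_TuN n => (T n%:R * u_lift (-1)%R)%g
  | F_Ta n l => (T n%:R * a_lift l)%g
  | F_TNa n l => (T (- n%:R) * a_lift l)%g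
  | F_Trho n th => (T n%:R * rho_lift th)%g
  | F_TN1Nrho n th => (T (-1 - n%:R) * rho_lift th)%g
  end.

Definition class_form_sharp (c : class_form) : Rsharp R :=
  match c with
  | F_id => sharp_pt R 0
  | F_u | F_uN | F_a _ | F_rho _ | F_TN1rho _ => sharp_itv R 0
  | F_T n | F_TN n | F_Tu n | F_TNuN n => sharp_pt R n
  | F_TNu n | F_TuN n | F_Ta n _ | F_TNa n _ | F_Trho n _ | F_TN1Nrho n _ =>
      sharp_itv R n
  end.

End Forms.

(* Main.v *)
(* A lift [f] covers a matrix [A] when [A] sends the line at angle [pi x] to the line at angle
   [pi (f x)]; [SL2t] is the set of lifts covering some matrix of determinant 1, and two lifts
   of the same matrix differ by an integral translation, which is central.  Every matrix of
   [SL_2] has a lift: a positive definite one turns each line by an angle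
   [atan (cross / dot)] of absolute value less than [pi / 2], and the polar decomposition
   reduces to that case.  Hence the conjugacy classes are those of [PSL_2] times integral
   translations, and a list of forms is obtained from the normal forms of real matrices.

   The displacement order relations [f t <= t + k] and [t + k <= f t] are invariant under
   conjugation by any increasing map commuting with [x |-> x + 1].  They determine [ell_sharp]
   and separate all the forms, except for two values of the parameter of [a] or of [rho]: the
   trace up to sign separates the former, and the rotation number the latter. *)
Require Import Defs.
From HB Require Import structures.
From mathcomp Require Import all_boot all_order all_algebra.
From mathcomp Require Import all_classical all_reals all_analysis.
From mathcomp Require Import ring lra zify.

Set Implicit Arguments.
Unset Strict Implicit.
Unset Printing Implicit Defensive.

Import Order.TTheory GRing.Theory Num.Theory.
Import numFieldNormedType.Exports.
Local Open Scope classical_set_scope.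
Local Open Scope ring_scope.
Local Open Scope quotient_scope.

(** * Explicit 2 by 2 matrices and unit directions in the plane *)

Section Plane.
Variable R : realType.
Implicit Types (a b c d p q r x y : R) (A B : 'M[R]_2) (v : 'cV[R]_2).

(** The body repeats the matrix inside [psl_mx], so that the two are convertible in [psl_mxE]. *)
Definition mx2 a b c d : 'M[R]_2 :=
  \matrix_(i < 2, j < 2)
    if i == 0 then (if j == 0 then a else b) else (if j == 0 then c else d).

Definition cv2 p q : 'cV[R]_2 := \col_(i < 2) if i == 0 then p else q.

Lemma mx2P A : A = mx2 (A 0 0) (A 0 1) (A 1 0) (A 1 1).
Proof.
apply/matrixP => i j; rewrite mxE.
by case: (unliftP 0 i) => [i'|] ->; case: (unliftP 0 j) => [j'|] ->;
  rewrite ?ord1 /=; congr (A _ _); apply/val_inj.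
Qed.

Lemma cv2P v : v = cv2 (v 0 0) (v 1 0).
Proof.
apply/matrixP => i j; rewrite mxE ord1.
by case: (unliftP 0 i) => [i'|] ->; rewrite ?ord1 /=; congr (v _ _); apply/val_inj.
Qed.

Lemma mul_mx2 a b c d a' b' c' d' :
  mx2 a b c d *m mx2 a' b' c' d'
  = mx2 (a * a' + b * c') (a * b' + b * d') (c * a' + d * c') (c * b' + d * d').
Proof. by rewrite [LHS]mx2P; congr mx2; rewrite !mxE !big_ord_recl big_ord0 !mxE /= addr0. Qed.

Lemma mul_mx2_cv2 a b c d p q :
  mx2 a b c d *m cv2 p q = cv2 (a * p + b * q) (c * p + d * q).
Proof. by rewrite [LHS]cv2P; congr cv2; rewrite !mxE !big_ord_recl big_ord0 !mxE /= addr0. Qed.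

Lemma scale_cv2 r p q : r *: cv2 p q = cv2 (r * p) (r * q).
Proof. by rewrite [LHS]cv2P; congr cv2; rewrite !mxE. Qed.

Lemma opp_mx2 a b c d : - mx2 a b c d = mx2 (- a) (- b) (- c) (- d).
Proof. by rewrite [LHS]mx2P; congr mx2; rewrite !mxE. Qed.

Lemma mx2_1 : 1%:M = mx2 1 0 0 1.
Proof. by rewrite [LHS]mx2P; congr mx2; rewrite !mxE. Qed.

Lemma det_mx2 a b c d : \det (mx2 a b c d) = a * d - b * c.
Proof.
rewrite (expand_det_row _ 0) !big_ord_recl big_ord0 /cofactor !det_mx11 !mxE /=.
by rewrite addr0 mul1r mulN1r mulrN.
Qed.

Lemma trace_mx2 a b c d : \tr (mx2 a b c d) = a + d.
Proof. by rewrite /mxtrace !big_ord_recl big_ord0 !mxE /= addr0. Qed.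

Lemma cv2_inj p q p' q' : cv2 p q = cv2 p' q' -> p = p' /\ q = q'.
Proof.
move=> e; have E i := congr1 (fun v : 'cV[R]_2 => v i 0) e.
by have := (E 0, E 1); rewrite !mxE /= => -[].
Qed.

Lemma line_dirE x : line_dir x = cv2 (cos (pi * x)) (sin (pi * x)).
Proof. by []. Qed.

Lemma pi_neq0 : pi != 0 :> R. Proof. by rewrite gt_eqF // pi_gt0. Qed.

Lemma line_dirD1 x : line_dir (x + 1) = - line_dir x.
Proof. by rewrite -scaleN1r !line_dirE scale_cv2 mulrDr mulr1 cosDpi sinDpi !mulN1r. Qed.

Lemma line_dir_neq0 x : line_dir x != 0.
Proof.
apply/eqP; rewrite line_dirE -[0](scale0r (cv2 0 0)) scale_cv2 mul0r => /cv2_inj[c0 s0].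
by have := cos2Dsin2 (pi * x); rewrite c0 s0 expr0n /= addr0 => /eqP; rewrite eq_sym oner_eq0.
Qed.

Lemma sin_pi_gt0 x : 0 < x < 1 -> 0 < sin (pi * x).
Proof.
move=> /andP[x0 x1]; apply: sin_gt0_pi.
by rewrite mulr_gt0 ?pi_gt0 //= gtr_pMr ?pi_gt0.
Qed.

Lemma line_dirDz x (n : int) : exists2 e : R, e != 0 & line_dir (x + n%:~R) = e *: line_dir x.
Proof.
have step (y : R) (m : nat) : line_dir (y + m%:R) = (-1) ^+ m *: line_dir y.
  elim: m => [|m IHm]; first by rewrite addr0 scale1r.
  by rewrite -natr1 addrA line_dirD1 IHm exprS -scalerA scaleN1r.
have sg (m : nat) : (-1 : R) ^+ m != 0 by rewrite expf_neq0 // oppr_eq0 oner_neq0.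
case: n => m; first by exists ((-1) ^+ m); [exact: sg|exact: step].
exists ((-1) ^+ m.+1); first exact: sg.
rewrite NegzE mulrNz -[in RHS](subrK m.+1%:~R x) step.
by rewrite scalerA -exprMn mulrNN mulr1 expr1n scale1r.
Qed.

(** Removing the floor brings [x] into [0, 1), where the sine is positive except at 0. *)
Lemma sin_pi_int x : sin (pi * x) = 0 -> x \is a Num.int.
Proof.
move=> s0; pose n := Num.floor x.
have /andP[y0 y1] : 0 <= x - n%:~R < 1.
  by rewrite subr_ge0 floor_le ltrBlDl -intrD1 floorD1_gt.
have [e _] := line_dirDz x (- n); rewrite !line_dirE scale_cv2 s0 mulr0 mulrNz => /cv2_inj[_ sy].
move: y0; rewrite le_eqVlt => /orP[/eqP|] y0.
  by rewrite -[x](subrK n%:~R) -y0 add0r intr_int.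
by have := @sin_pi_gt0 (x - n%:~R); rewrite y0 y1 sy ltxx => /(_ isT).
Qed.

(** Up to sign, the sine of [pi * (x - y)] is the determinant of the two directions. *)
Lemma line_dir_colinear r x y : line_dir x = r *: line_dir y -> x - y \is a Num.int.
Proof.
rewrite !line_dirE scale_cv2 => /cv2_inj[ec es]; apply: sin_pi_int.
by rewrite mulrBr sinB ec es; ring.
Qed.

(** For a nonzero vector, [acos (p / r)] is an argument when [q >= 0], and its opposite is one when
    [q < 0]. *)
Lemma polar v : exists2 r, 0 <= r & exists x, v = r *: line_dir x.
Proof.
rewrite (cv2P v); move: (v 0 0) (v 1 0) => p q.
pose r := Num.sqrt (p ^+ 2 + q ^+ 2).
have r2 : r ^+ 2 = p ^+ 2 + q ^+ 2 by rewrite sqr_sqrtr // addr_ge0 ?sqr_ge0.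
have r0 : 0 <= r by rewrite sqrtr_ge0.
have [rz|rnz] := eqVneq r 0.
  move: r2; rewrite rz expr0n /= => /esym/eqP; rewrite paddr_eq0 ?sqr_ge0 // !sqrf_eq0.
  by move=> /andP[/eqP -> /eqP ->]; exists 0 => //; exists 0;
    rewrite scale0r -[RHS](scale0r (cv2 0 0)) scale_cv2 !mul0r.
have rp : 0 < r by rewrite lt_neqAle eq_sym rnz.
have pr : -1 <= p / r <= 1 by rewrite ler_pdivlMr // ler_pdivrMr //; nra.
have sa : sin (acos (p / r)) = `|q| / r.
  rewrite sin_acos // -[r in RHS](ger0_norm r0) -normf_div -sqrtr_sqr; congr Num.sqrt.
  by rewrite !expr_div_n r2; field; rewrite -r2 expf_neq0.
have ca : cos (acos (p / r)) = p / r by rewrite acosK // in_itv.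
have [q0|q0] := leP 0 q.
  exists r => //; exists (acos (p / r) / pi);
    rewrite line_dirE scale_cv2 mulrCA mulfV ?pi_neq0 // mulr1.
  by rewrite ca sa ger0_norm //; congr cv2; field.
exists r => //; exists (- (acos (p / r) / pi));
  rewrite line_dirE scale_cv2 mulrN mulrCA mulfV ?pi_neq0 // mulr1.
by rewrite cosN sinN ca sa ltr0_norm //; congr cv2; field.
Qed.

End Plane.

(** * Lifts that cover a matrix, and their composition and uniqueness *)

Section Covers.
Variable R : realType.
Implicit Types (f g : liftHomeo R) (A B : 'M[R]_2) (x y r : R).

(** A continuous injection is monotone, and [f 1 = f 0 + 1] forces it to increase. *)
Lemma lh_leE f : {mono f : x y / x <= y}.
Proof.
have in_setT x : x \in `]-oo, +oo[ by rewrite in_itv.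
move=> x y; apply: (@itv_continuous_inj_le _ f `]-oo, +oo[) => //.
- by exists 0, 1; split; rewrite // -[1]add0r lh_funD1 lerDl.
- exact/continuous_subspaceT/lh_fun_continuous.
- by move=> u v _ _ /(can_inj (lh_funK f)).
Qed.

Lemma lh_ltE f : {mono f : x y / x < y}.
Proof. exact/leW_mono/lh_leE. Qed.

Lemma lh_mulE f g x : (f * g)%g x = f (g x). Proof. by []. Qed.

Lemma lh_mulV_inv f x : f^-1%g (f x) = x. Proof. exact: lh_funK. Qed.

(** For [y] in [0, 1), monotonicity puts [f y] in [f 0, f 0 + 1) and [g y] in [g 0, g 0 + 1). The
    integers [f y - g y] and [f 0 - g 0] then differ by less than 1, hence agree. *)
Lemma lh_eq_transl f g : (forall x, f x - g x \is a Num.int) ->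
  exists n : int, f = (transl n%:~R * g)%g.
Proof.
move=> fg; have /intrP[n fg0] := fg 0; exists n; apply: liftHomeoP => x.
rewrite lh_mulE /=; have /intrP[m] := fg x; pose k := Num.floor x.
pose y := x - k%:~R; have xE : x = y + k%:~R by rewrite subrK.
have /andP[y0 y1] : 0 <= y < 1 by rewrite subr_ge0 floor_le ltrBlDl -intrD1 floorD1_gt.
rewrite xE !lh_funDz opprD addrACA subrr addr0 => fgm.
have f0 : f 0 <= f y by rewrite lh_leE.
have f1 : f y < f 0 + 1 by rewrite -lh_funD1 lh_ltE add0r.
have g0 : g 0 <= g y by rewrite lh_leE.
have g1 : g y < g 0 + 1 by rewrite -lh_funD1 lh_ltE add0r.
have mn : m < n + 1 by rewrite -(ltr_int R) intrD; lra.
have nm : n < m + 1 by rewrite -(ltr_int R) intrD; lra.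
have mnE : m = n by apply/eqP; rewrite eq_le -!ltzD1 mn nm.
by move: fgm; rewrite mnE; lra.
Qed.

(** The scalar is free, in particular in sign, so that [A] and [- A] are covered by the same lifts;
    it is nonzero as soon as [\det A = 1]. *)
Definition covers A f := forall x, exists r, A *m line_dir x = r *: line_dir (f x).

Lemma pi_circleP x y : \pi_(circle R) x = \pi_(circle R) y <-> x - y \is a Num.int.
Proof. by split=> [/eqP|h]; [|apply/eqP]; rewrite eqmodE. Qed.

Lemma mulmx_line_dir_neq0 A x : \det A = 1 -> A *m line_dir x != 0.
Proof.
move=> A1; have Au : A \in unitmx by rewrite unitmxE A1 unitr1.
apply/eqP => Ax0; have := line_dir_neq0 x.
by rewrite -(mulKmx Au (line_dir x)) Ax0 mulmx0 eqxx.
Qed.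

Lemma mulmx_line_dir_scale_neq0 A r x y :
  \det A = 1 -> A *m line_dir x = r *: line_dir y -> r != 0.
Proof.
by move=> A1; apply: contra_eqN => /eqP ->; rewrite scale0r mulmx_line_dir_neq0.
Qed.

Lemma polar_mulmx A x : \det A = 1 ->
  exists2 r, r != 0 & exists y, A *m line_dir x = r *: line_dir y.
Proof.
move=> A1; have [r _ [y Ay]] := polar (A *m line_dir x); exists r; last by exists y.
exact: mulmx_line_dir_scale_neq0 Ay.
Qed.

Lemma vline_scale r (v : 'cV[R]_2) : r != 0 -> <[r *: v]>%VS = <[v]>%VS.
Proof.
move=> r0; apply/eqP; rewrite eqEsubv -!memvE memvZ ?memv_line //=.
by rewrite -{1}(scalerK r0 v) memvZ ?memv_line.
Qed.

(** Two parameters of the same line differ by an integer, so the choice made by [line_circle] is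
    forced. *)
Lemma line_circle_dir x : line_circle <[line_dir x]>%VS = \pi_(circle R) x.
Proof.
apply: xget_unique => /=; first exact: circle_line_pi.
move=> p; rewrite -[p]reprK circle_line_pi => px.
have : line_dir (repr p) \in <[line_dir x]>%VS by rewrite -px memv_line.
by move=> /vlineP[k /line_dir_colinear] /pi_circleP.
Qed.

Lemma covers_int A f g : covers A f -> (forall x, f x - g x \is a Num.int) -> covers A g.
Proof.
move=> Af fg x; have [r Ar] := Af x; have /intrP[n fgn] := fg x.
have [e _ de] := line_dirDz (g x) n; exists (r * e).
by rewrite Ar -scalerA -de -fgn addrC subrK.
Qed.

(** Replaces an equality of maps on quotients by a condition on vectors: the class of [x] goes to
    the line spanned by [A *m line_dir x]. *)
Lemma circle_map_psl A (A1 : \det A == 1) f :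
  circle_map f = psl_circle (\pi_(PSL2 R) (exist _ A A1)) <-> covers A f.
Proof.
have act x : psl_act (\pi_(PSL2 R) (exist _ A A1)) (circle_line (\pi_(circle R) x))
    = <[A *m line_dir x]>%VS.
  by rewrite psl_act_pi circle_line_pi limg_line lfunE.
split=> [fA x|Af].
  have [r _ [y Ay]] := polar_mulmx x (eqP A1).
  have [e e0 de] : exists2 e : R, e != 0 & line_dir y = e *: line_dir (f x).
    have : \pi_(circle R) (f x) = \pi_(circle R) y.
      rewrite -circle_map_pi fA /psl_circle act Ay -line_circle_dir; congr line_circle.
      by rewrite vline_scale // (mulmx_line_dir_scale_neq0 (eqP A1) Ay).
    move=> /esym/pi_circleP/intrP[n yf]; have [e e0 de] := line_dirDz (f x) n.
    by exists e => //; rewrite -de -yf addrC subrK.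
  by exists (r * e); rewrite Ay de scalerA.
apply/funext => p; rewrite -[p]reprK circle_map_pi /psl_circle act.
have [r Ar] := Af (repr p); rewrite Ar vline_scale ?line_circle_dir //.
exact: mulmx_line_dir_scale_neq0 (eqP A1) Ar.
Qed.

Lemma SL2tP f : SL2t f <-> exists2 A, \det A = 1 & covers A f.
Proof.
split=> [[g]|[A /eqP A1 /(circle_map_psl A1) fA]]; last by exists (\pi_(PSL2 R) (exist _ A A1)).
rewrite -[g]reprK; case: (repr g) => A A1 /circle_map_psl Af.
by exists A => //; apply/eqP.
Qed.

Lemma covers_mul A B f g : covers A f -> covers B g -> covers (A *m B) (f * g)%g.
Proof.
move=> Af Bg x; have [s Bs] := Bg x; have [r Ar] := Af (g x).
by exists (s * r); rewrite -mulmxA Bs -scalemxAr Ar scalerA.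
Qed.

Lemma covers_inv A f : \det A = 1 -> covers A f -> covers (invmx A) f^-1%g.
Proof.
move=> A1 Af x; have [r] := Af (f^-1%g x).
have Au : A \in unitmx by rewrite unitmxE A1 unitr1.
rewrite -lh_mulE mulgV => Ar.
have r0 := mulmx_line_dir_scale_neq0 A1 Ar.
by exists r^-1; rewrite -[line_dir x](scalerK r0) -Ar -scalemxAr mulKmx.
Qed.

Lemma covers_opp A f : covers A f -> covers (- A) f.
Proof. by move=> Af x; have [r Ar] := Af x; exists (- r); rewrite mulNmx Ar scaleNr. Qed.

Lemma covers_translz A f (n : int) : covers A f -> covers A (transl n%:~R * f)%g.
Proof.
move=> Af; apply: (covers_int Af) => x; rewrite lh_mulE /= opprD addNKr rpredN.
exact: intr_int.
Qed.

Lemma covers_uniq A f g : \det A = 1 -> covers A f -> covers A g ->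
  exists n : int, f = (transl n%:~R * g)%g.
Proof.
move=> A1 Af Ag; apply: lh_eq_transl => x; have [r Ar] := Af x; have [s As] := Ag x.
have r0 := mulmx_line_dir_scale_neq0 A1 Ar.
by apply: (@line_dir_colinear _ (r^-1 * s)); rewrite -scalerA -As Ar scalerK.
Qed.

(** The matrix [invmx A *m B] covers the identity, so every vector is an eigenvector and the matrix
    is scalar; determinant 1 leaves the scalars 1 and -1. *)
Lemma covers_fun_inj A B f : \det A = 1 -> \det B = 1 -> covers A f -> covers B f ->
  A = B \/ A = - B.
Proof.
move=> A1 B1 Af Bf; pose C := invmx A *m B.
have Au : A \in unitmx by rewrite unitmxE A1 unitr1.
have Cid : covers C 1%g by rewrite -(mulVg f); apply: covers_mul => //; apply: covers_inv.
have C1 : \det C = 1 by rewrite det_mulmx det_inv A1 B1 invr1 mulr1.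
have eigC (v : 'cV[R]_2) : exists r, C *m v = r *: v.
  have [r _ [x ->]] := polar v; have [s Cs] := Cid x.
  by exists s; rewrite -scalemxAr Cs !scalerA mulrC.
have BE : B = A *m C by rewrite mulKVmx.
move: C1 eigC BE; rewrite (mx2P C); move: (C 0 0) (C 0 1) (C 1 0) (C 1 1) => a b c d.
rewrite det_mx2 => C1 eigC.
(* The basis vectors make the matrix diagonal, and their sum makes its diagonal entries equal. *)
have [r] := eigC (cv2 1 0); rewrite mul_mx2_cv2 scale_cv2 => /cv2_inj[_].
have [s] := eigC (cv2 0 1); rewrite mul_mx2_cv2 scale_cv2 => /cv2_inj[+ _].
have [t] := eigC (cv2 1 1); rewrite mul_mx2_cv2 scale_cv2 => /cv2_inj[].
rewrite !mulr0 !mulr1 !add0r !addr0 => + + b0 c0; rewrite b0 c0 in C1 *.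
rewrite addr0 add0r => at_ dt; rewrite at_ dt in C1 *.
have /eqP : t ^+ 2 = 1 by rewrite -C1; ring.
rewrite sqrf_eq1 => /orP[]/eqP -> ->; first by left; rewrite -mx2_1 mulmx1.
by right; rewrite -oppr0 -opp_mx2 -mx2_1 mulmxN mulmx1 opprK.
Qed.

Lemma SL2t1 : SL2t (1%g : liftHomeo R).
Proof.
apply/SL2tP; exists 1%:M; first by rewrite det1.
by move=> x; exists 1; rewrite mul1mx scale1r.
Qed.

Lemma SL2tM f g : SL2t f -> SL2t g -> SL2t (f * g)%g.
Proof.
move=> /SL2tP[A A1 Af] /SL2tP[B B1 Bg]; apply/SL2tP; exists (A *m B).
  by rewrite det_mulmx A1 B1 mulr1.
exact: covers_mul.
Qed.

Lemma SL2tV f : SL2t f -> SL2t f^-1%g.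
Proof.
move=> /SL2tP[A A1 Af]; apply/SL2tP; exists (invmx A); last exact: covers_inv.
by rewrite det_inv A1 invr1.
Qed.

End Covers.

(** * Existence of a lift for every matrix of determinant 1 *)

Section Lift.
Variable R : realType.
Implicit Types (f g : liftHomeo R) (A B : 'M[R]_2) (a b c d x y r : R).

(** Inner product of [line_dir x] with its image under the matrix; [dir_cross] is the determinant of
    the same two vectors. *)
Definition dir_dot a b c d x : R :=
  a * cos (pi * x) ^+ 2 + (b + c) * (cos (pi * x) * sin (pi * x)) + d * sin (pi * x) ^+ 2.

Definition dir_cross a b c d x : R :=
  c * cos (pi * x) ^+ 2 + (d - a) * (cos (pi * x) * sin (pi * x)) - b * sin (pi * x) ^+ 2.

(** Where [dir_dot] is positive, this is the angle from [line_dir x] to its image, in units of [pi].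
    It then stays within a right angle, so no branch of the argument has to be chosen. *)
Definition turn a b c d x : R := atan (dir_cross a b c d x / dir_dot a b c d x) / pi.

Lemma turn_lt a b c d x : `|turn a b c d x| < 2^-1.
Proof.
rewrite ltr_norml /turn ltr_pdivrMr ?ltr_pdivlMr ?pi_gt0 // mulNr ![2^-1 * _]mulrC.
by rewrite atan_gtNpi2 atan_ltpi2.
Qed.

Lemma turnD1 a b c d x : turn a b c d (x + 1) = turn a b c d x.
Proof.
by rewrite /turn /dir_cross /dir_dot mulrDr mulr1 cosDpi sinDpi !sqrrN mulrNN.
Qed.

Lemma mul_line_dir_turn a b c d x : 0 < dir_dot a b c d x ->
  exists r, mx2 a b c d *m line_dir x = r *: line_dir (x + turn a b c d x).
Proof.
move=> L0; set t := atan (dir_cross a b c d x / dir_dot a b c d x).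
have ct : 0 < cos t by apply: cos_gt0_pihalf; rewrite atan_gtNpi2 atan_ltpi2.
have st : sin t = dir_cross a b c d x / dir_dot a b c d x * cos t.
  by rewrite -[_ / _]atanK /tan divfK ?gt_eqF.
(* The norm of the image: its component along [line_dir x] divided by the cosine of the angle. *)
exists (dir_dot a b c d x / cos t); rewrite !line_dirE mul_mx2_cv2 scale_cv2.
have -> : pi * (x + turn a b c d x) = pi * x + t by rewrite mulrDr mulrCA mulfV ?pi_neq0 // mulr1.
rewrite cosD sinD st; move: L0 ct; rewrite /dir_dot /dir_cross.
have := cos2Dsin2 (pi * x); move: (cos (pi * x)) (sin (pi * x)) (cos t) => C S z CS1 L0 z0.
have z0' : z != 0 by rewrite gt_eqF.
have L0' := lt0r_neq0 L0.
congr cv2.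
  (* The factor equal to 1 homogenizes the equation, which becomes a formal identity for [field]. *)
  transitivity ((a * C + b * S) * (C ^+ 2 + S ^+ 2)); first by rewrite CS1 mulr1.
  by field; rewrite z0' L0'.
transitivity ((c * C + d * S) * (C ^+ 2 + S ^+ 2)); first by rewrite CS1 mulr1.
by field; rewrite z0' L0'.
Qed.

Lemma turn_continuous a b c d : (forall x, 0 < dir_dot a b c d x) -> continuous (turn a b c d).
Proof.
move=> L0 x; have mulpi_cont : {for x, continuous (fun x : R => pi * x)}.
  by apply: cvgM; [exact: cvg_cst|exact: cvg_id].
have C : {for x, continuous (fun x : R => cos (pi * x))}.
  by apply: continuous_comp => //; exact: continuous_cos.
have S : {for x, continuous (fun x : R => sin (pi * x))}.
  by apply: continuous_comp => //; exact: continuous_sin.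
have sq (u : R -> R) : {for x, continuous u} -> {for x, continuous (fun x => u x ^+ 2)}.
  by move=> uc; apply: cvgM.
apply: cvgM; last exact: cvg_cst.
apply: (@continuous_comp _ _ _ (fun x => dir_cross a b c d x / dir_dot a b c d x) atan); last first.
  exact: continuous_atan.
rewrite /dir_cross /dir_dot; apply: cvgM; last apply: cvgV.
- by apply: cvgB; [apply: cvgD|]; apply: cvgM; try exact: cvg_cst; try exact: sq; apply: cvgM.
- by rewrite gt_eqF // L0.
- by apply: cvgD; [apply: cvgD|]; apply: cvgM; try exact: cvg_cst; try exact: sq; apply: cvgM.
Qed.

(** The second map belongs to the inverse matrix, so the composite moves [x] by an integer. Each
    turn is less than 1/2 in absolute value, so this integer is 0. *)
Lemma turn_cancel a b c d : a * d - b * c = 1 ->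
  (forall x, 0 < dir_dot a b c d x) -> (forall x, 0 < dir_dot d (- b) (- c) a x) ->
  cancel (fun x => x + turn a b c d x) (fun x => x + turn d (- b) (- c) a x).
Proof.
move=> det1 L0 L0' x; set y := x + _; set z := y + _.
have [r dy] := mul_line_dir_turn (L0 x); have [s dz] := mul_line_dir_turn (L0' y).
have /intrP[n] : x - z \is a Num.int.
  apply: (@line_dir_colinear _ (r * s)); rewrite -scalerA -dz scalemxAr -dy mulmxA mul_mx2.
  have -> : mx2 (d * a + - b * c) (d * b + - b * d) (- c * a + a * c) (- c * b + a * d) = 1%:M.
    by rewrite mx2_1; congr mx2; rewrite -?det1; ring.
  by rewrite mul1mx.
have := turn_lt a b c d x; have := turn_lt d (- b) (- c) a y;
  rewrite -/y -/z !ltr_norml => zy yx xz.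
have n1 : n < 1 by rewrite -(ltr_int R); move: zy yx; rewrite /z /y in xz *; lra.
have n0 : -1 < n by rewrite -(ltr_int R) mulrN1z; move: zy yx; rewrite /z /y in xz *; lra.
have n00 : n = 0 by lia.
by move: xz; rewrite n00; lra.
Qed.

Lemma covers_posdef a b c d : a * d - b * c = 1 -> (forall x, 0 < dir_dot a b c d x) ->
  exists f, covers (mx2 a b c d) f.
Proof.
move=> det1 L0.
(* Adding 1/2 turns the direction by a right angle, which exchanges the quadratic forms of the
   matrix and of its inverse. *)
have L0' x : 0 < dir_dot d (- b) (- c) a x.
  have := L0 (x + 2^-1); rewrite /dir_dot mulrDr cosDpihalf sinDpihalf sqrrN; lra.
have shift_cont (h : R -> R) : continuous h -> continuous (fun x => x + h x).
  by move=> hc x; apply: cvgD; [exact: cvg_id|exact: hc].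
have det1' : d * a - - b * - c = 1 by rewrite -det1; ring.
have K' := turn_cancel det1'; rewrite !opprK in K'.
exists (LiftHomeo (turn_cancel det1 L0 L0') (K' L0' L0)
  (shift_cont _ (turn_continuous L0)) (shift_cont _ (turn_continuous L0'))
  (fun x => etrans (congr1 _ (turnD1 a b c d x)) (addrAC x 1 (turn a b c d x)))).
by move=> x; apply: mul_line_dir_turn.
Qed.

Definition rot x : 'M[R]_2 := mx2 (cos (pi * x)) (- sin (pi * x)) (sin (pi * x)) (cos (pi * x)).

Lemma covers_rot x : covers (rot x) (transl x).
Proof.
move=> y; exists 1; rewrite !line_dirE mul_mx2_cv2 scale1r /= mulrDr cosD sinD.
by congr cv2; ring.
Qed.

(* Polar decomposition: rotating back by the argument of [a + d + i (c - b)] makes the matrix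
   symmetric positive definite. *)
Lemma covers_exists A : \det A = 1 -> exists f, covers A f.
Proof.
rewrite (mx2P A); move: (A 0 0) (A 0 1) (A 1 0) (A 1 1) => a b c d; rewrite det_mx2 => det1.
have [r r0 [x]] := polar (cv2 (a + d) (c - b)); rewrite line_dirE scale_cv2 => /cv2_inj[tr cr].
have := cos2Dsin2 (pi * x); set C := cos _ in tr *; set S := sin _ in cr * => CS1.
have [g Pg] : exists g, covers (mx2 (C * a + S * c) (C * b + S * d) (C * c - S * a) (C * d - S *
  b)) g.
  apply: covers_posdef.
    by rewrite -[RHS]mulr1 -{1}CS1 -det1; ring.
  move=> y; rewrite /dir_dot; set p := C * a + S * c; set s := C * d - S * b.
  have qE : C * c - S * a = C * b + S * d.
    by apply/eqP; rewrite -subr_eq0; apply/eqP; transitivity (C * (c - b) - S * (a + d));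
      [|rewrite tr cr]; ring.
  rewrite qE; set q := C * b + S * d.
  have ps : p * s = 1 + q ^+ 2.
    transitivity ((a * d - b * c) * (C ^+ 2 + S ^+ 2) + (C * c - S * a) * q).
      by rewrite /p /s /q; ring.
    by rewrite det1 CS1 mulr1 qE expr2.
  have psr : p + s = r.
    transitivity (C * (a + d) + S * (c - b)); first by rewrite /p /s; ring.
    by rewrite tr cr -[RHS]mulr1 -CS1; ring.
  (* The product of [p] and [s] is positive and their sum [r] is nonnegative. *)
  have p0 : 0 < p by nra.
  move: (cos2Dsin2 (pi * y)); move: (cos (pi * y)) (sin (pi * y)) => u v uv.
  (* After multiplication by [p] the form is a sum of two squares, because [p * s - q ^+ 2 = 1]. *)
  rewrite -(pmulr_rgt0 _ p0).
  have -> : p * (p * u ^+ 2 + (q + q) * (u * v) + s * v ^+ 2) = (p * u + q * v) ^+ 2 + v ^+ 2.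
    by rewrite !mulrDr [p * (s * _)]mulrA ps; ring.
  rewrite lt_neqAle addr_ge0 ?sqr_ge0 // andbT eq_sym paddr_eq0 ?sqr_ge0 // !sqrf_eq0.
  apply/negP => /andP[+ /eqP v0]; rewrite v0 mulr0 addr0 mulf_eq0 gt_eqF //= => /eqP u0.
  by move: uv; rewrite u0 v0 expr0n /= addr0 => /eqP; rewrite eq_sym oner_eq0.
exists (transl x * g)%g; have := covers_mul (covers_rot x) Pg; rewrite mul_mx2 -/C -/S.
congr (covers (mx2 _ _ _ _) _).
- by rewrite -[RHS]mul1r -CS1; ring.
- by rewrite -[RHS]mul1r -CS1; ring.
- by rewrite -[RHS]mul1r -CS1; ring.
- by rewrite -[RHS]mul1r -CS1; ring.
Qed.

End Lift.

(** * The displacement of a lift, and what conjugation preserves of it *)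

Section Displacement.
Variable R : realType.
Implicit Types (f g : liftHomeo R) (A B : 'M[R]_2) (p q s l t x y r : R) (k : int) (n : nat).

Lemma frac_itv x : exists k y, x = y + k%:~R /\ 0 <= y < 1.
Proof.
exists (Num.floor x), (x - (Num.floor x)%:~R); rewrite subrK subr_ge0 floor_le ltrBlDl.
by rewrite -intrD1 floorD1_gt.
Qed.

Lemma disp_frac f t : exists2 y, 0 <= y < 1 & f t - t = f y - y.
Proof.
have [k [y [-> y01]]] := frac_itv t; exists y => //.
by rewrite lh_funDz opprD addrACA subrr addr0.
Qed.

(** The extreme value theorem on [0, 1], extended to all points by periodicity of the
    displacement. *)
Lemma ell_max f : exists t, ell f = `|f t - t| /\ forall s, `|f s - s| <= ell f.
Proof.
have [|c c01 cmax] := @EVT_max R (fun t => `|f t - t|) 0 1 ler01.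
  apply: continuous_subspaceT => x; apply: (@continuous_comp _ _ _ (fun t => f t - t) Num.norm);
    last exact: norm_continuous.
  by apply: cvgB; [exact: lh_fun_continuous|exact: cvg_id].
have ellE : ell f = `|f c - c|.
  apply/eqP; rewrite eq_le; apply/andP; split.
    by apply: ge_sup => [|_ [t t01 <-]]; [exists `|f c - c|, c|exact: cmax].
  by apply: ub_le_sup; [exists `|f c - c| => _ [t t01 <-]; exact: cmax|exists c].
exists c; split=> // s; rewrite ellE; have [y /andP[y0 y1] ->] := disp_frac f s.
by apply: cmax; rewrite in_itv /= y0 ltW.
Qed.

Lemma ell_sharp_ptP f n :
  (forall t, `|f t - t| <= n%:R) -> (exists t, `|f t - t| = n%:R) ->
  ell_sharp f = sharp_pt R n.
Proof.
move=> fn [t ft]; have [c [ellE cmax]] := ell_max f.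
by congr (\pi_(Rsharp R) _); apply/eqP; rewrite -pmulrn eq_le {1}ellE fn -ft cmax.
Qed.

(** The strict pointwise bound passes to [ell f] because the supremum is attained. *)
Lemma ell_sharp_itvP f n :
  (forall t, `|f t - t| < n.+1%:R) -> (exists t, n%:R < `|f t - t|) ->
  ell_sharp f = sharp_itv R n.
Proof.
move=> fn [t ft]; have [c [ellE cmax]] := ell_max f; apply: sharp_itvE.
by rewrite (lt_le_trans ft (cmax t)) ellE (lt_le_trans (fn c)) // -natr1 intrD.
Qed.

(** [g] is increasing and commutes with integral translations, so integral bounds at [t] become
    integral bounds at [g t]; [ell_sharp] records only such bounds. *)
Lemma conj_le g f t k : ((g * f * g^-1)%g (g t) <= g t + k%:~R) = (f t <= t + k%:~R).
Proof. by rewrite !lh_mulE lh_mulV_inv -lh_funDz lh_leE. Qed.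

Lemma conj_ge g f t k : (g t + k%:~R <= (g * f * g^-1)%g (g t)) = (t + k%:~R <= f t).
Proof. by rewrite !lh_mulE lh_mulV_inv -lh_funDz lh_leE. Qed.

Lemma conj_eq g f t k : ((g * f * g^-1)%g (g t) == g t + k%:~R) = (f t == t + k%:~R).
Proof. by rewrite !eq_le conj_le conj_ge. Qed.

Lemma conj_norm_le g f t n : (`|(g * f * g^-1)%g (g t) - g t| <= n%:R) = (`|f t - t| <= n%:R).
Proof.
have E x y : (`|x - y| <= n%:R) = (y + (- n%:Z)%:~R <= x) && (x <= y + n%:Z%:~R).
  by rewrite ler_norml lerBlDl lerBrDl mulrNz.
by rewrite !E conj_le conj_ge.
Qed.

Lemma conj_sharp_pt g f n : (forall t, `|f t - t| <= n%:R) -> (exists t, `|f t - t| = n%:R) ->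
  ell_sharp (g * f * g^-1)%g = sharp_pt R n.
Proof.
move=> fn [t ft]; have surj s : s = g (g^-1%g s) by rewrite -lh_mulE mulgV.
apply: ell_sharp_ptP => [s|]; first by rewrite [s]surj conj_norm_le.
have E x y : (`|x - y| == n%:R) = (x == y + n%:Z%:~R) || (x == y + (- n%:Z)%:~R).
  by rewrite eqr_norml ler0n andbT !subr_eq mulrNz ![_ + y]addrC.
by exists (g t); apply/eqP; move/eqP: ft; rewrite !E !conj_eq.
Qed.

Lemma conj_sharp_itv g f n :
  (forall t, `|f t - t| < n.+1%:R) -> (exists t, n%:R < `|f t - t|) ->
  ell_sharp (g * f * g^-1)%g = sharp_itv R n.
Proof.
move=> fn [t ft]; have surj s : s = g (g^-1%g s) by rewrite -lh_mulE mulgV.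
apply: ell_sharp_itvP => [s|]; last by exists (g t); rewrite ltNge conj_norm_le -ltNge.
have E x y : (`|x - y| < n.+1%:R) = (y + (- n.+1%:Z)%:~R < x) && (x < y + n.+1%:Z%:~R).
  by rewrite ltr_norml ltrBlDl ltrBrDl mulrNz.
by have := fn (g^-1%g s); rewrite [s in X in _ -> X]surj !E !ltNge conj_le conj_ge.
Qed.

End Displacement.

(** * Canonical liftings and the sign of their displacement *)

Section CanonicalLifts.
Variable R : realType.
Implicit Types (f g : liftHomeo R) (A B : 'M[R]_2) (a b c d p q s l t x y r th z : R) (k : int)
  (n : nat).

Lemma psl_mxE a b c d (h : \det (mx2 a b c d) == 1) :
  psl_mx a b c d = \pi_(PSL2 R) (exist _ (mx2 a b c d) h).
Proof. by congr (\pi_(PSL2 R) _); apply/val_inj; rewrite insubdK. Qed.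

Lemma int_itv01 k x y : 0 <= x < 1 -> 0 <= y < 1 -> x = y + k%:~R -> k = 0.
Proof.
move=> /andP[x0 x1] /andP[y0 y1] xy.
have : k < 1 by rewrite -(ltr_int R); lra.
have : -1 < k by rewrite -(ltr_int R) mulrN1z; lra.
lia.
Qed.

Lemma canonical_lift_psl_mx a b c d f : a * d - b * c = 1 ->
  covers (mx2 a b c d) f -> 0 <= f 0 < 1 -> canonical_lift (psl_circle (psl_mx a b c d)) = f.
Proof.
move=> det1 Af f01; have A1 : \det (mx2 a b c d) == 1 by rewrite det_mx2 det1.
rewrite (psl_mxE A1); apply: xget_unique => /=; first by split=> //; apply/circle_map_psl.
move=> g [/circle_map_psl Ag g01]; have [k gE] := covers_uniq (eqP A1) Ag Af.
have k0 : k = 0 by apply: int_itv01 g01 f01 _; rewrite gE.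
by apply: liftHomeoP => x; rewrite gE k0 lh_mulE /= addr0.
Qed.

(** Any lift of the matrix becomes canonical once the floor of its value at 0 is removed. *)
Lemma covers_canonical_lift a b c d : a * d - b * c = 1 ->
  let f := canonical_lift (psl_circle (psl_mx a b c d)) in
  covers (mx2 a b c d) f /\ 0 <= f 0 < 1.
Proof.
move=> det1; have A1 : \det (mx2 a b c d) = 1 by rewrite det_mx2.
have [g Ag] := covers_exists A1; have [k [y [g0 y01]]] := frac_itv (g 0).
have Af := covers_translz (- k) Ag; set f := (transl _ * g)%g in Af.
have f01 : 0 <= f 0 < 1 by rewrite /f lh_mulE /= g0 mulrNz addrK.
by rewrite /= (canonical_lift_psl_mx det1 Af f01).
Qed.

(** The horizontal line, at parameter 0, is invariant, so [f 0] is an integer in [0, 1). *)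
Lemma covers_upper_fix0 p q s f : p * s = 1 ->
  covers (mx2 p q 0 s) f -> 0 <= f 0 < 1 -> f 0 = 0.
Proof.
move=> ps Af f01; have [r f0] := Af 0.
have r0 : r != 0 by apply: mulmx_line_dir_scale_neq0 f0; rewrite det_mx2 mulr0 subr0.
move: f0; rewrite !line_dirE mul_mx2_cv2 scale_cv2 !mulr0 sin0 cos0 !mulr0 mul0r !addr0.
move=> /cv2_inj[_ /esym/eqP]; rewrite mulf_eq0 (negPf r0) /= => /eqP/sin_pi_int/intrP[k f0].
by rewrite f0 (@int_itv01 k (f 0) 0) // ?f0 ?add0r // lexx ltr01.
Qed.

Lemma disp_lt1 f t : f 0 = 0 -> `|f t - t| < 1.
Proof.
move=> f0; have [y /andP[y0 y1] ->] := disp_frac f t.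
have fy0 : 0 <= f y by rewrite -f0 lh_leE.
have fy1 : f y < 1 by rewrite -[1]add0r -f0 -lh_funD1 lh_ltE add0r.
by rewrite ltr_norml; apply/andP; split; lra.
Qed.

(** Both sides compute the determinant of a direction and its image. The scalar is positive since
    that image and [line_dir (f x)] both lie in the open upper half-plane. *)
Lemma disp_cross p q s f x : p * s = 1 -> 0 < s -> covers (mx2 p q 0 s) f -> f 0 = 0 ->
  0 < x < 1 -> exists2 r, 0 < r & dir_cross p q 0 s x = r * sin (pi * (f x - x)).
Proof.
move=> ps s0 Af f0 x01; have [r] := Af x.
rewrite !line_dirE mul_mx2_cv2 scale_cv2 mul0r add0r => /cv2_inj[fc fs].
have /andP[x0 x1] := x01.
have fx0 : 0 < f x by rewrite -f0 lh_ltE.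
have fx1 : f x < 1 by rewrite -[1]add0r -f0 -lh_funD1 lh_ltE add0r.
exists r; first by rewrite -(@pmulr_lgt0 _ (sin (pi * f x))) ?sin_pi_gt0 ?fx0 // -fs mulr_gt0
  ?sin_pi_gt0.
rewrite mulrBr sinB.
transitivity (r * sin (pi * f x) * cos (pi * x) - r * cos (pi * f x) * sin (pi * x)); last by ring.
by rewrite -fs -fc /dir_cross; ring.
Qed.

Lemma sin_pi_gt0E z : `|z| < 1 -> (0 < sin (pi * z)) = (0 < z).
Proof.
rewrite ltr_norml => /andP[zN1 z1]; have [z0|z0|<-] := ltgtP 0 z.
- by rewrite sin_pi_gt0 // z0.
- apply/negbTE; rewrite -leNgt -oppr_ge0 -sinN -mulrN ltW // sin_pi_gt0 //.
  by rewrite oppr_gt0 z0 ltrNl.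
- by rewrite mulr0 sin0 ltxx.
Qed.

Lemma sin_pi_lt0E z : `|z| < 1 -> (sin (pi * z) < 0) = (z < 0).
Proof. by move=> z1; rewrite -oppr_gt0 -sinN -mulrN sin_pi_gt0E ?normrN // oppr_gt0. Qed.

Lemma disp_gt0 p q s f x : p * s = 1 -> 0 < s -> covers (mx2 p q 0 s) f -> f 0 = 0 ->
  0 < x < 1 -> (0 < f x - x) = (0 < dir_cross p q 0 s x).
Proof.
move=> ps s0 Af f0 x01; have [r r0 ->] := disp_cross ps s0 Af f0 x01.
by rewrite pmulr_rgt0 // sin_pi_gt0E // disp_lt1.
Qed.

Lemma disp_lt0 p q s f x : p * s = 1 -> 0 < s -> covers (mx2 p q 0 s) f -> f 0 = 0 ->
  0 < x < 1 -> (f x - x < 0) = (dir_cross p q 0 s x < 0).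
Proof.
move=> ps s0 Af f0 x01; have [r r0 ->] := disp_cross ps s0 Af f0 x01.
by rewrite pmulr_rlt0 // sin_pi_lt0E // disp_lt1.
Qed.

Lemma rho_liftE th : 0 <= th < pi -> rho_lift th = transl (th / pi).
Proof.
move=> /andP[th0 thpi]; apply: canonical_lift_psl_mx.
- by rewrite mulNr opprK -!expr2 cos2Dsin2.
- by have := covers_rot (th / pi); rewrite /rot mulrCA mulfV ?pi_neq0 // mulr1.
- by rewrite /= add0r divr_ge0 ?pi_ge0 //= ltr_pdivrMr ?pi_gt0 // mul1r.
Qed.

Lemma covers_u_lift q : covers (mx2 1 q 0 1) (u_lift q).
Proof. by have [] := @covers_canonical_lift 1 q 0 1 _ => //; ring. Qed.

Lemma u_lift0 q : u_lift q 0 = 0.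
Proof.
have [Af f01] := @covers_canonical_lift 1 q 0 1 (ltac:(ring)).
by apply: covers_upper_fix0 Af f01; rewrite mulr1.
Qed.

Lemma covers_a_lift l : 0 < l -> covers (mx2 l 0 0 l^-1) (a_lift l).
Proof.
by move=> l0; have [] := @covers_canonical_lift l 0 0 l^-1 _ => //;
  rewrite mulfV ?gt_eqF // mul0r subr0.
Qed.

Lemma a_lift0 l : 0 < l -> a_lift l 0 = 0.
Proof.
move=> l0; have ll : l * l^-1 = 1 by rewrite mulfV ?gt_eqF.
have [Af f01] := @covers_canonical_lift l 0 0 l^-1 (ltac:(by rewrite ll mul0r subr0)).
exact: covers_upper_fix0 Af f01.
Qed.

(** For [q > 0] every line but the horizontal one turns clockwise, so [u_lift 1] moves points down
    and [u_lift (-1)] moves them up. *)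
Lemma dir_cross_u q x : dir_cross 1 q 0 1 x = - q * sin (pi * x) ^+ 2.
Proof. by rewrite /dir_cross; ring. Qed.

Lemma u_lift1_disp_lt0 x : 0 < x < 1 -> u_lift 1 x - x < 0.
Proof.
move=> x01; rewrite (disp_lt0 _ _ (covers_u_lift 1)) ?u_lift0 ?mulr1 // dir_cross_u mulN1r oppr_lt0.
by rewrite exprn_gt0 // sin_pi_gt0.
Qed.

Lemma u_lift1_disp t : u_lift 1 t - t <= 0.
Proof.
have [y /andP[y0 y1] ->] := disp_frac (u_lift 1) t.
move: y0; rewrite le_eqVlt => /orP[/eqP <-|y0]; first by rewrite u_lift0 subr0.
by rewrite ltW // u_lift1_disp_lt0 ?y0.
Qed.

Lemma u_liftN1_disp_gt0 x : 0 < x < 1 -> 0 < u_lift (-1) x - x.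
Proof.
move=> x01; rewrite (disp_gt0 _ _ (covers_u_lift (-1))) ?u_lift0 ?mulr1 // dir_cross_u opprK mul1r.
by rewrite exprn_gt0 // sin_pi_gt0.
Qed.

Lemma u_liftN1_disp t : 0 <= u_lift (-1) t - t.
Proof.
have [y /andP[y0 y1] ->] := disp_frac (u_lift (-1)) t.
move: y0; rewrite le_eqVlt => /orP[/eqP <-|y0]; first by rewrite u_lift0 subr0.
by rewrite ltW // u_liftN1_disp_gt0 ?y0.
Qed.

Lemma half_itv01 : 0 < (2^-1 : R) < 1.
Proof. by apply/andP; split; lra. Qed.

Lemma dir_cross_a l x :
  dir_cross l 0 0 l^-1 x = (l^-1 - l) * (cos (pi * x) * sin (pi * x)).
Proof. by rewrite /dir_cross; ring. Qed.

(** The parameter 1/4 is the diagonal direction, where the product of cosine and sine is positive;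
    it is negative at 3/4. *)
Lemma a_lift_disp_neg l : 1 < l -> a_lift l 4^-1 - 4^-1 < 0.
Proof.
move=> l1; have l0 : 0 < l by lra.
have h : 0 < (4^-1 : R) < 1 by apply/andP; split; lra.
have lV : 0 < l^-1 by rewrite invr_gt0.
have ll : l * l^-1 = 1 by rewrite mulfV ?gt_eqF.
rewrite (disp_lt0 ll lV (covers_a_lift l0) (a_lift0 l0) h) dir_cross_a.
rewrite pmulr_llt0 ?subr_lt0 ?(lt_trans _ l1) ?invf_lt1 // mulr_gt0 ?sin_pi_gt0 //.
by apply: cos_gt0_pihalf; rewrite -mulrN ltr_pM2l ?ltr_pM2l ?pi_gt0 //; lra.
Qed.

Lemma a_lift_disp_pos l : 1 < l -> 0 < a_lift l (4^-1 + 2^-1) - (4^-1 + 2^-1).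
Proof.
move=> l1; have l0 : 0 < l by lra.
have h : 0 < (4^-1 : R) < 1 by apply/andP; split; lra.
have h' : 0 < (4^-1 + 2^-1 : R) < 1 by apply/andP; split; lra.
have lV : 0 < l^-1 by rewrite invr_gt0.
have ll : l * l^-1 = 1 by rewrite mulfV ?gt_eqF.
rewrite (disp_gt0 ll lV (covers_a_lift l0) (a_lift0 l0) h') dir_cross_a.
(* The shift by 1/2 is a right angle: it changes the sign of the product and leaves the factors at
   1/4. *)
rewrite mulrDr cosDpihalf sinDpihalf mulNr mulrN -mulNr opprB.
rewrite pmulr_lgt0 ?subr_gt0 ?(lt_trans _ l1) ?invf_lt1 // mulr_gt0 ?sin_pi_gt0 //.
by apply: cos_gt0_pihalf; rewrite -mulrN ltr_pM2l ?ltr_pM2l ?pi_gt0 //; lra.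
Qed.

End CanonicalLifts.

(** * Normal forms of matrices of determinant 1, up to conjugation and sign *)

Section NormalForms.
Variable R : realType.
Implicit Types (f g h : liftHomeo R) (A B C P : 'M[R]_2) (a b c d p q s t x y r : R).

(** Conjugacy of the classes in PSL_2, written without inverses so that each instance is a
    polynomial identity between entries. *)
Definition pconj A B := exists2 P, \det P = 1 & P *m A = B *m P \/ P *m A = - (B *m P).

Lemma pconj_refl A : pconj A A.
Proof. by exists 1%:M; [rewrite det1|left; rewrite mul1mx mulmx1]. Qed.

Lemma pconj_trans B A C : pconj A B -> pconj B C -> pconj A C.
Proof.
move=> [P P1 PA] [Q Q1 QB]; exists (Q *m P); first by rewrite det_mulmx P1 Q1 mulr1.
rewrite -mulmxA; case: PA => ->; rewrite ?mulmxN mulmxA; case: QB => ->;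
  rewrite ?mulNmx ?opprK -mulmxA; by [left|right].
Qed.

Lemma pconj_opp A B : pconj (- A) B -> pconj A B.
Proof.
move=> [P P1 PA]; exists P => //; move: PA; rewrite mulmxN.
by case=> /(congr1 -%R); rewrite !opprK => ->; [right|left].
Qed.

(** The angle is the arc cosine of half the trace. Its sine is positive, so a negative [c] is first
    made positive by passing to the opposite matrix; [c = 0] would give a squared trace of at least
    4. *)
Lemma pconj_elliptic a b c d : a * d - b * c = 1 -> (a + d) ^+ 2 < 4 ->
  exists2 th, 0 < th < pi & pconj (mx2 a b c d) (mx2 (cos th) (- sin th) (sin th) (cos th)).
Proof.
have pos a' b' c' d' : 0 < c' -> a' * d' - b' * c' = 1 -> (a' + d') ^+ 2 < 4 ->
  exists2 th, 0 < th < pi & pconj (mx2 a' b' c' d') (mx2 (cos th) (- sin th) (sin th) (cos th)).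
  move=> {a b c d}; move: a' b' c' d' => a b c d c0 det1 t4.
  have t2 : -1 < (a + d) / 2 < 1 by apply/andP; split; nra.
  have /andP[t2l t2r] := t2.
  have th0 : 0 < acos ((a + d) / 2) by rewrite acos_gt0 // ltW.
  have thpi : acos ((a + d) / 2) < pi by rewrite acos_ltpi // t2l ltW.
  exists (acos ((a + d) / 2)); first by rewrite th0.
  have cE : cos (acos ((a + d) / 2)) = (a + d) / 2 by rewrite acosK // in_itv /= !ltW.
  have s0 : 0 < sin (acos ((a + d) / 2)) by rewrite sin_gt0_pi // th0.
  have := cos2Dsin2 (acos ((a + d) / 2)); rewrite cE; move: (sin _) s0 => s s0 cs.
  (* An upper triangular conjugator suffices: the ratio of its diagonal entries turns [c] into [s],
     determinant 1 fixes [m], and the remaining entry balances the diagonal. *)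
  pose m := Num.sqrt (s / c); have m2 : m ^+ 2 = s / c by rewrite sqr_sqrtr // ltW // divr_gt0.
  have c0' := lt0r_neq0 c0; have s0' := lt0r_neq0 s0.
  exists (mx2 (m * (c / s)) (- m * ((a - d) / (2 * s))) 0 m).
    by rewrite det_mx2 mulr0 subr0 mulrAC -expr2 m2; field; rewrite c0' s0'.
  left; rewrite !mul_mx2; congr mx2; rewrite ?mul0r ?mulr0 ?add0r ?addr0.
  - by field.
  - have bE : b = (a * d - 1) / c by rewrite -det1; field.
    have s2 : s ^+ 2 = 1 - ((a + d) / 2) ^+ 2 by apply: (addIr (((a + d) / 2) ^+ 2));
      rewrite subrK addrC.
    have -> : - s * m = - ((1 - ((a + d) / 2) ^+ 2) / s) * m by rewrite -s2; field.
    by rewrite bE; field; rewrite c0' s0'.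
  - by field.
  - by field.
move=> det1 t4; have [c0|c0|c0] := ltgtP c 0; last 2 first.
- exact: pos.
- by exfalso; move: det1; rewrite c0 mulr0 subr0; have := sqr_ge0 (a - d); nra.
have [|||th th_pi e] := @pos (- a) (- b) (- c) (- d); [lra|rewrite -det1;
  ring|by rewrite -opprD sqrrN|].
by exists th => //; apply: pconj_opp; rewrite opp_mx2.
Qed.

(** There is a real eigenvalue [l], with eigenvector [(l - d, c)] when [c] is nonzero; a rotation
    brings this vector to the horizontal axis. *)
Lemma pconj_triangular a b c d : a * d - b * c = 1 -> 4 <= (a + d) ^+ 2 ->
  exists p q s, p * s = 1 /\ pconj (mx2 a b c d) (mx2 p q 0 s).
Proof.
move=> det1 t4; have [c0|c0] := eqVneq c 0.
  by exists a, b, d; rewrite c0 in det1 *; split; [lra|exact: pconj_refl].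
pose w := Num.sqrt ((a + d) ^+ 2 - 4); have w2 : w ^+ 2 = (a + d) ^+ 2 - 4.
  by rewrite sqr_sqrtr // subr_ge0.
pose l := (a + d + w) / 2.
have l2 : l ^+ 2 - (a + d) * l + 1 = 0.
  transitivity ((w ^+ 2 - (a + d) ^+ 2 + 4) / 4); first by rewrite /l; field.
  by rewrite w2; ring.
have [r r0 [x]] := polar (cv2 (l - d) c); rewrite line_dirE scale_cv2 => /cv2_inj[ldE cE].
have rn0 : r != 0 by apply: contra_neq c0 => r00; rewrite cE r00 mul0r.
have CS1 := cos2Dsin2 (pi * x).
move: (cos (pi * x)) (sin (pi * x)) ldE cE CS1 => C S ldE cE CS1.
(* The determinant of the eigenvector and its image vanishes; this is the lower left entry after
   rotation. *)
have low : C * (c * C + d * S) - S * (a * C + b * S) = 0.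
  apply: (mulfI (expf_neq0 2 rn0)); rewrite mulr0.
  transitivity ((r * C) * (c * (r * C) + d * (r * S)) - (r * S) * (a * (r * C) + b * (r * S))).
    by ring.
  rewrite -ldE -cE; transitivity (c * (l ^+ 2 - (a + d) * l + (a * d - b * c))); first by ring.
  by rewrite det1 l2 mulr0.
exists (C * (a * C + b * S) + S * (c * C + d * S)), (C * (b * C - a * S) + S * (d * C - c * S)),
  (C * (d * C - c * S) - S * (b * C - a * S)); split.
  transitivity ((a * d - b * c) * (C ^+ 2 + S ^+ 2) ^+ 2 + 
     (C * (b * C - a * S) + S * (d * C - c * S)) * (C * (c * C + d * S) - S * (a * C + b * S))).
    by ring.
  by rewrite det1 CS1 low mulr0 expr1n addr0 mulr1.
exists (mx2 C S (- S) C); first by rewrite det_mx2 mulrN opprK -!expr2.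
left; rewrite -low !mul_mx2; congr mx2.
- transitivity ((C ^+ 2 + S ^+ 2) * (C * a + S * c)); [by rewrite CS1 mul1r|by ring].
- transitivity ((C ^+ 2 + S ^+ 2) * (C * b + S * d)); [by rewrite CS1 mul1r|by ring].
- transitivity ((C ^+ 2 + S ^+ 2) * (- S * a + C * c)); [by rewrite CS1 mul1r|by ring].
- transitivity ((C ^+ 2 + S ^+ 2) * (- S * b + C * d)); [by rewrite CS1 mul1r|by ring].
Qed.

(** The shear brings the second eigenline to the vertical axis. *)
Lemma pconj_diag p q s : p * s = 1 -> p != s -> pconj (mx2 p q 0 s) (mx2 p 0 0 s).
Proof.
move=> ps pNs; exists (mx2 1 (q / (p - s)) 0 1); first by rewrite det_mx2; ring.
by left; rewrite !mul_mx2; congr mx2; field; rewrite ?subr_eq0.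
Qed.

Lemma pconj_swap p s : pconj (mx2 p 0 0 s) (mx2 s 0 0 p).
Proof.
exists (mx2 0 (-1) 1 0); first by rewrite det_mx2; ring.
by left; rewrite !mul_mx2; congr mx2; ring.
Qed.

(** A diagonal conjugator rescales the off-diagonal entry by a square, which keeps its sign. *)
Lemma pconj_unipotent q e : 0 < q -> pconj (mx2 1 (e * q) 0 1) (mx2 1 e 0 1).
Proof.
move=> q0; pose m := Num.sqrt q; have m0 : m != 0 by rewrite gt_eqF // sqrtr_gt0.
have qE : q = m ^+ 2 by rewrite sqr_sqrtr // ltW.
exists (mx2 m^-1 0 0 m); first by rewrite det_mx2; field.
by left; rewrite !mul_mx2 qE; congr mx2; field.
Qed.

(** Representatives for PSL_2; each listed form is an integral translate of one of them. *)
Inductive base_form := B_id | B_u | B_uN | B_a of R | B_rho of R.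

Definition base_valid e :=
  match e with B_id | B_u | B_uN => true | B_a l => 1 < l | B_rho th => 0 < th < pi end.

Definition base_repr e : liftHomeo R :=
  match e with
  | B_id => 1%g
  | B_u => u_lift 1
  | B_uN => u_lift (-1)
  | B_a l => a_lift l
  | B_rho th => rho_lift th
  end.

Definition base_mx e : 'M[R]_2 :=
  match e with
  | B_id => 1%:M
  | B_u => mx2 1 1 0 1
  | B_uN => mx2 1 (-1) 0 1
  | B_a l => mx2 l 0 0 l^-1
  | B_rho th => mx2 (cos th) (- sin th) (sin th) (cos th)
  end.

Lemma det_base_mx e : base_valid e -> \det (base_mx e) = 1.
Proof.
case: e => [|||l l1|th _] /=; rewrite ?det1 // det_mx2 ?mulr0 ?subr0 ?mulr1 //.
  by rewrite mulfV // gt_eqF // (lt_trans ltr01 l1).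
by rewrite mulNr opprK -!expr2 cos2Dsin2.
Qed.

Lemma covers_base e : base_valid e -> covers (base_mx e) (base_repr e).
Proof.
case: e => [_|_|_|l l1|th /andP[th0 thpi]] /=; try exact: covers_u_lift.
- by move=> x; exists 1; rewrite mul1mx scale1r.
- by apply: covers_a_lift; apply: lt_trans l1.
rewrite rho_liftE ?(ltW th0) //.
by have := covers_rot (th / pi); rewrite /rot mulrCA mulfV ?pi_neq0 // mulr1.
Qed.

(** A change of sign makes [p] positive. For [p] different from 1 the matrix is diagonalizable, with
    entries swapped if [p < 1]; for [p = 1] the sign of [q] decides. *)
Lemma pconj_triangular_base p q s : p * s = 1 ->
  exists2 e, base_valid e & pconj (mx2 p q 0 s) (base_mx e).
Proof.
have pos p' q' s' : 0 < p' -> p' * s' = 1 ->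
  exists2 e, base_valid e & pconj (mx2 p' q' 0 s') (base_mx e).
  move=> {p q s}; move: p' q' s' => p q s p0 ps.
  have sE : s = p^-1 by apply: (mulfI (lt0r_neq0 p0)); rewrite ps mulfV ?lt0r_neq0.
  have [p1|p1|p1] := ltgtP p 1.
  - have s1 : 1 < s by rewrite sE invf_gt1.
    exists (B_a s) => //=; rewrite {3}sE invrK.
    apply: pconj_trans (pconj_swap _ _); apply: pconj_diag => //.
    by rewrite lt_eqF // (lt_trans p1).
  - exists (B_a p) => //=; rewrite -sE; apply: pconj_diag => //.
    by rewrite gt_eqF // sE (lt_trans _ p1) // invf_lt1.
  have s1 : s = 1 by rewrite sE p1 invr1.
  rewrite p1 s1; have [q0|q0|->] := ltgtP q 0.
  - exists B_uN => //=; have := @pconj_unipotent (- q) (-1).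
    by rewrite mulN1r opprK oppr_gt0; apply.
  - by exists B_u => //=; have := @pconj_unipotent q 1 q0; rewrite mul1r.
  - by exists B_id => //=; rewrite mx2_1; exact: pconj_refl.
move=> ps; have [p0|p0|p0] := ltgtP 0 p.
- exact: pos.
- have [||e ev pe] := @pos (- p) (- q) (- s); rewrite ?oppr_gt0 ?mulrNN //.
  by exists e => //; apply: pconj_opp; rewrite opp_mx2 oppr0.
- by move: ps; rewrite -p0 mul0r => /eqP; rewrite eq_sym oner_eq0.
Qed.

Lemma pconj_base A : \det A = 1 -> exists2 e, base_valid e & pconj A (base_mx e).
Proof.
rewrite (mx2P A) det_mx2 => det1; have [t4|t4] := ltP ((A 0 0 + A 1 1) ^+ 2) 4.
  by have [th th_pi] := pconj_elliptic det1 t4; exists (B_rho th).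
have [p [q [s [ps Aps]]]] := pconj_triangular det1 t4.
have [e ev pe] := pconj_triangular_base q ps.
by exists e => //; apply: pconj_trans pe.
Qed.

(** A lift [g] of the conjugating matrix conjugates [f] to a lift of the normal form, and lifts of
    one matrix differ by an integral translation. *)
Lemma SL2t_conj_base f : SL2t f -> exists g k e, [/\ SL2t g, base_valid e &
  (g * f * g^-1)%g = (transl k%:~R * base_repr e)%g].
Proof.
move=> /SL2tP[A A1 Af]; have [e ev [P P1 PA]] := pconj_base A1.
have [g Pg] := covers_exists P1; have Pu : P \in unitmx by rewrite unitmxE P1 unitr1.
have gfg := covers_mul (covers_mul Pg Af) (covers_inv P1 Pg).
have {}gfg : covers (base_mx e) (g * f * g^-1)%g.
  case: PA gfg => ->; first by rewrite mulmxK.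
  by rewrite mulNmx mulmxK // => /covers_opp; rewrite opprK.
have [k gk] := covers_uniq (det_base_mx ev) gfg (covers_base ev).
by exists g, k, e; split=> //; apply/SL2tP; exists P.
Qed.

End NormalForms.

(** * The listed forms as translates of the base forms, and their lengths *)

Section Classes.
Variable R : realType.
Implicit Types (f g h : liftHomeo R) (e : base_form R) (c : class_form R) (t u v x y l m th : R)
  (k : int) (n : nat).

(** Since [Negz n] is [-(n + 1)], negative indices become [n.+1] in the list, except for rotations,
    whose listed translation [-1 - n] already contains the shift. *)
Definition shift_form k e : class_form R :=
  match e, k with
  | B_id, Posz 0 => F_id R
  | B_id, Posz n => F_T R n
  | B_id, Negz n => F_TN R n.+1
  | B_u, Posz 0 => F_u R
  | B_u, Posz n => F_Tu R n
  | B_u, Negz n => F_TNu R n.+1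
  | B_uN, Posz 0 => F_uN R
  | B_uN, Posz n => F_TuN R n
  | B_uN, Negz n => F_TNuN R n.+1
  | B_a l, Posz 0 => F_a l
  | B_a l, Posz n => F_Ta n l
  | B_a l, Negz n => F_TNa n.+1 l
  | B_rho th, Posz 0 => F_rho th
  | B_rho th, Posz n => F_Trho n th
  | B_rho th, Negz 0 => F_TN1rho th
  | B_rho th, Negz n => F_TN1Nrho n th
  end.

Lemma shift_form_valid k e : base_valid e -> class_form_valid (shift_form k e).
Proof. by case: e => [|||l|th]; case: k => -[|n] //= ->. Qed.

Lemma shift_form_repr k e :
  class_form_repr (shift_form k e) = (transl k%:~R * base_repr e)%g.
Proof.
have T0 f : f = (transl 0 * f)%g by apply: liftHomeoP => x; rewrite lh_mulE /= addr0.
have T1 u : transl u = (transl u * 1)%g by rewrite mulg1.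
case: e => [|||l|th]; case: k => -[|n] //=; rewrite ?NegzE -?T1 ?mulrNz //.
(* The remaining case is the rotation translated by [-(n + 2)], listed as [-1 - (n + 1)]. *)
by congr (transl _ * _)%g; rewrite -[n.+2%:~R]/(n.+2%:R) -[n.+2]add1n natrD opprD.
Qed.

Lemma shift_form_ex c : class_form_valid c -> exists k e, base_valid e /\ c = shift_form k e.
Proof.
case: c => [|||l|th|th|[]//n|[]//n|[]//n|[]//n|[]//n|[]//n|[]//n l|[]//n l|[]//n th|[]//n th] /= v.
- by exists 0, (B_id R).
- by exists 0, (B_u R).
- by exists 0, (B_uN R).
- by exists 0, (B_a l).
- by exists 0, (B_rho th).
- by exists (Negz 0), (B_rho th).
- by exists n.+1, (B_id R).
- by exists (Negz n), (B_id R).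
- by exists n.+1, (B_u R).
- by exists (Negz n), (B_uN R).
- by exists (Negz n), (B_u R).
- by exists n.+1, (B_uN R).
- by exists n.+1, (B_a l).
- by exists (Negz n), (B_a l).
- by exists n.+1, (B_rho th).
- by exists (Negz n.+1), (B_rho th).
Qed.

Lemma translz_disp k f t : (transl k%:~R * f)%g t - t = (f t - t) + k%:~R.
Proof. by rewrite lh_mulE /= addrAC. Qed.

(** Translation by [k] adds [k] to the displacement, so the range of the displacement of each base
    form decides whether the length is an integer, and which one. *)
Lemma conj_base_sharp g k e : base_valid e ->
  ell_sharp (g * (transl k%:~R * base_repr e) * g^-1)%g = class_form_sharp (shift_form k e).
Proof.
have natE n : n%:~R = n%:R :> R by [].
have NegE n : (Negz n)%:~R = - (n%:R + 1) :> R by rewrite NegzE mulrNz natE natr1.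
have n0 n : 0 <= n%:R :> R by rewrite ler0n.
case: e => [_|_|_|l l1|th /andP[th0 thpi]].
- have d t : (1%g : liftHomeo R) t - t = 0 by exact: subrr.
  by case: k => [[|n]|n] /=; apply: conj_sharp_pt => [t|]; try exists 0;
    rewrite translz_disp d add0r ?NegE ?normrN ger0_norm // ?natr1.
- have d t : -1 < u_lift 1 t - t <= 0.
    by rewrite u_lift1_disp andbT; have := disp_lt1 t (u_lift0 (1 : R));
      rewrite ltr_norml => /andP[].
  have d0 : u_lift 1 0 - 0 = 0 :> R by rewrite u_lift0 subrr.
  have dh := u_lift1_disp_lt0 (half_itv01 R).
  (* The displacement of [u_lift 1] is in (-1, 0] and vanishes at 0: a positive [k] is attained as
     the length, and otherwise the point 1/2 exceeds the absolute value of [k]. *)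
  case: k => [[|n]|n] /=.
  + apply: conj_sharp_itv => [t|]; last (exists 2^-1); rewrite translz_disp addr0.
      by rewrite ltr_norml; have := d t; lra.
    by rewrite ltr_normr; lra.
  + apply: conj_sharp_pt => [t|]; last (exists 0); rewrite translz_disp natE; have := n0 n.
      by rewrite ler_norml; have := d t; lra.
    by rewrite d0 add0r => ?; rewrite ger0_norm //; lra.
  + apply: conj_sharp_itv => [t|]; last (exists 2^-1); rewrite translz_disp NegE; have := n0 n.
      by rewrite ltr_norml; have := d t; lra.
    by rewrite ltr_normr; lra.
- have d t : 0 <= u_lift (-1) t - t < 1.
    by rewrite u_liftN1_disp; have := disp_lt1 t (u_lift0 (-1 : R)); rewrite ltr_norml => /andP[].
  have d0 : u_lift (-1) 0 - 0 = 0 :> R by rewrite u_lift0 subrr.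
  have dh := u_liftN1_disp_gt0 (half_itv01 R).
  case: k => n /=.
  + rewrite (_ : class_form_sharp _ = sharp_itv R n); last by case: n.
    apply: conj_sharp_itv => [t|]; last (exists 2^-1); rewrite translz_disp natE; have := n0 n.
      by rewrite ltr_norml; have := d t; lra.
    by rewrite ltr_normr; lra.
  + apply: conj_sharp_pt => [t|]; last (exists 0); rewrite translz_disp NegE; have := n0 n.
      by rewrite ler_norml; have := d t; lra.
    by rewrite d0 add0r => ?; rewrite normrN ger0_norm //; lra.
- have l0 : 0 < l by apply: lt_trans l1.
  have d t : -1 < a_lift l t - t < 1.
    by have := disp_lt1 t (a_lift0 l0); rewrite ltr_norml.
  have dp := a_lift_disp_pos l1; have dn := a_lift_disp_neg l1.
  (* Both signs occur, so the witness is the point whose displacement has the sign of [k]: 3/4 for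
     nonnegative [k], 1/4 for negative [k]. *)
  case: k => n /=.
  + rewrite (_ : class_form_sharp _ = sharp_itv R n); last by case: n.
    apply: conj_sharp_itv => [t|]; last (exists (4^-1 + 2^-1)); rewrite translz_disp natE;
      have := n0 n.
      by rewrite ltr_norml; have := d t; lra.
    by rewrite ltr_normr; lra.
  + apply: conj_sharp_itv => [t|]; last (exists 4^-1); rewrite translz_disp NegE; have := n0 n.
      by rewrite ltr_norml; have := d t; lra.
    by rewrite ltr_normr; lra.
rewrite /base_repr rho_liftE ?(ltW th0) //.
have u0 : 0 < th / pi by rewrite divr_gt0 ?pi_gt0.
have u1 : th / pi < 1 by rewrite ltr_pdivrMr ?pi_gt0 // mul1r.
have d t : transl (th / pi) t - t = th / pi by rewrite /= addrC addKr.
(* The constant displacement is in (0, 1); adding [-(n + 1)] leaves an absolute value in (n, n + 1),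
   hence the index [n] for [Negz n]. *)
rewrite (_ : class_form_sharp _ = sharp_itv R ((if k is Negz n then n else `|k|%N) : nat));
  last first.
  by case: k => -[].
apply: conj_sharp_itv => [t|]; last (exists 0); rewrite translz_disp d; case: k => n.
- by rewrite natE ltr_norml; have := n0 n; rewrite absz_nat; lra.
- by rewrite NegE ltr_norml; have := n0 n; lra.
- by rewrite natE ltr_normr absz_nat; have := n0 n; lra.
- by rewrite NegE ltr_normr; have := n0 n; lra.
Qed.

End Classes.

(** * Separation of the conjugacy classes *)

Section Distinct.
Variable R : realType.
Implicit Types (f g h : liftHomeo R) (e : base_form R) (t u v x y l m th : R) (k : int) (n : nat).

Lemma translzC k f : (transl k%:~R * f)%g = (f * transl k%:~R)%g.
Proof. by apply: liftHomeoP => x; rewrite !lh_mulE /= lh_funDz. Qed.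

Lemma conj_disp_npos g f :
  (forall t, (g * f * g^-1)%g t <= t) <-> (forall t, f t <= t).
Proof.
have E t : ((g * f * g^-1)%g (g t) <= g t) = (f t <= t).
  by have := conj_le g f t 0; rewrite !addr0.
split=> h t; first by rewrite -E.
by rewrite -[t](lh_invK g) E.
Qed.

Lemma conj_disp_nneg g f :
  (forall t, t <= (g * f * g^-1)%g t) <-> (forall t, t <= f t).
Proof.
have E t : (g t <= (g * f * g^-1)%g (g t)) = (t <= f t).
  by have := conj_ge g f t 0; rewrite !addr0.
split=> h t; first by rewrite -E.
by rewrite -[t](lh_invK g) E.
Qed.

(** Invariance of the rotation number: iteration gives [g (n * u) = g 0 + n * v], while [g x - x]
    stays within 1 of [g 0], so [n * |v - u|] is bounded in [n]. *)
Lemma conj_transl_inj g u v : (g * transl u * g^-1)%g = transl v -> u = v.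
Proof.
move=> guv; have step x : g (x + u) = g x + v.
  have := congr1 (fun f : liftHomeo R => f (g x)) guv.
  by rewrite !lh_mulE lh_mulV_inv.
have stepn n : g (n%:R * u) = g 0 + n%:R * v.
  elim: n => [|n IHn]; first by rewrite !mul0r addr0.
  by rewrite -natr1 !mulrDl !mul1r step IHn addrA.
have near x : `|g x - x - g 0| <= 1.
  have [y /andP[y0 y1] ->] := disp_frac g x.
  have g0 : g 0 <= g y by rewrite lh_leE.
  have g1 : g y < g 0 + 1 by rewrite -lh_funD1 lh_ltE add0r.
  by rewrite ler_norml; apply/andP; split; lra.
have bound n : n%:R * `|v - u| <= 1.
  apply: le_trans (near (n%:R * u)); rewrite stepn -{1}(normr_nat R n) -normrM.
  by rewrite le_eqVlt; apply/orP; left; apply/eqP; congr `|_|; ring.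
apply/eqP; rewrite eq_sym -subr_eq0 -normr_eq0; apply/negPn/negP => d0.
have dp : 0 < `|v - u| by rewrite lt_neqAle eq_sym d0 normr_ge0.
have := bound (Num.bound `|v - u|^-1); apply/negP; rewrite -ltNge -ltr_pdivrMr // div1r.
by apply: archi_boundP; rewrite invr_ge0.
Qed.

(** Two matrices covering the same lift agree up to sign, and so do their traces. These are
    positive, so [l + l^-1 = m + m^-1], and the solution [l * m = 1] is excluded above 1. *)
Lemma conj_a_lift_inj g l m : SL2t g -> 1 < l -> 1 < m ->
  (g * a_lift l * g^-1)%g = a_lift m -> l = m.
Proof.
move=> /SL2tP[P P1 Pg] l1 m1 glm.
have l0 : 0 < l by apply: lt_trans l1.
have m0 : 0 < m by apply: lt_trans m1.
have Pu : P \in unitmx by rewrite unitmxE P1 unitr1.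
have det_a x : 0 < x -> \det (mx2 x 0 0 x^-1) = 1.
  by move=> x0; rewrite det_mx2 mulr0 subr0 mulfV // gt_eqF.
have := covers_mul (covers_mul Pg (covers_a_lift l0)) (covers_inv P1 Pg).
rewrite glm => /covers_fun_inj/(_ (covers_a_lift m0)).
rewrite !det_mulmx det_inv P1 invr1 !det_a // !mulr1 => /(_ erefl erefl) lmE.
have trE : \tr (P *m mx2 l 0 0 l^-1 *m invmx P) = l + l^-1.
  by rewrite mxtrace_mulC mulmxA mulVmx // mul1mx trace_mx2.
have lV : 0 < l^-1 by rewrite invr_gt0.
have mV : 0 < m^-1 by rewrite invr_gt0.
have E : l + l^-1 = m + m^-1.
  case: lmE trE => ->; rewrite ?opp_mx2 trace_mx2 // => h; lra.
have : (l - m) * (l * m - 1) = 0.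
  transitivity (l * m * ((l + l^-1) - (m + m^-1))); last by rewrite E subrr mulr0.
  by field; rewrite !gt_eqF.
move/eqP; rewrite mulf_eq0 !subr_eq0 => /orP[/eqP //|/eqP lm1].
by have := mulr_egt1 l1 m1; rewrite lm1 ltxx.
Qed.

Definition is_rho e := if e is B_rho _ then true else false.

Lemma base_repr0 e : base_valid e -> ~~ is_rho e -> base_repr e 0 = 0.
Proof.
case: e => [_ _|_ _|_ _|l l1 _|//]; first by [].
- exact: u_lift0.
- exact: u_lift0.
- by apply: a_lift0; apply: lt_trans l1.
Qed.

(** The two one-sided sign conditions on the displacement hold together for the identity, one at a
    time for the unipotent forms, and never for [B_a]. *)
Lemma base_sign e : base_valid e -> ~~ is_rho e ->
  ((forall t, base_repr e t <= t) <-> (e = B_id R \/ e = B_u R)) /\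
  ((forall t, t <= base_repr e t) <-> (e = B_id R \/ e = B_uN R)).
Proof.
have npos f t : f t - t < 0 -> ~ forall t, t <= f t by move=> ft /(_ t); lra.
have nneg f t : 0 < f t - t -> ~ forall t, f t <= t by move=> ft /(_ t); lra.
case: e => [|||l|th] //= v _; split; split; (try by [left|right|case]).
- by move=> _ t; rewrite -subr_le0 u_lift1_disp.
- by move/(npos _ _ (u_lift1_disp_lt0 (half_itv01 R))).
- by move/(nneg _ _ (u_liftN1_disp_gt0 (half_itv01 R))).
- by move=> _ t; rewrite -subr_ge0 u_liftN1_disp.
- by move/(nneg _ _ (a_lift_disp_pos v)).
- by move/(npos _ _ (a_lift_disp_neg v)).
Qed.

(** Rotations have a constant noninteger displacement, while the other base forms fix 0; this
    separates the two kinds. *)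
Lemma conj_base_inj g k e e' : SL2t g -> base_valid e -> base_valid e' ->
  (g * base_repr e * g^-1)%g = (transl k%:~R * base_repr e')%g -> k = 0 /\ e = e'.
Proof.
move=> Sg ve ve' gk.
have fixd t (n' : int) : (base_repr e t == t + n'%:~R) = (base_repr e' (g t) + k%:~R == g t +
  n'%:~R).
  by rewrite -(conj_eq g) gk lh_mulE.
have kint u (n' : int) : 0 < u < 1 -> u <> n'%:~R.
  move=> /andP[u0 u1] un; have : 0 < n' by rewrite -(ltr_int R) -un.
  have : n' < 1 by rewrite -(ltr_int R) -un.
  lia.
have rho01 th : 0 < th < pi -> 0 < th / pi < 1.
  by move=> /andP[th0 thpi]; rewrite divr_gt0 ?pi_gt0 //= ltr_pdivrMr ?pi_gt0 // mul1r.
have rhoE th : 0 < th < pi -> rho_lift th = transl (th / pi).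
  by move=> /andP[th0 thpi]; rewrite rho_liftE // ltW.
have [re|nre] := boolP (is_rho e); have [re'|nre'] := boolP (is_rho e').
- case: e e' re re' ve ve' gk {fixd} => // th [] // th' _ _ /= ve ve'; rewrite !rhoE // => gk.
  have uv : th / pi = th' / pi + k%:~R.
    by apply: (@conj_transl_inj g); rewrite gk; apply: liftHomeoP => x; rewrite lh_mulE /= addrA.
  have k0 : k = 0.
    by apply: (int_itv01 _ _ uv); apply/andP; have /andP[u0 u1] := rho01 _ ve;
      have /andP[u0' u1'] := rho01 _ ve'; split=> //; apply: ltW.
  split=> //; congr B_rho; apply: (divIf (pi_neq0 R)).
  by rewrite uv k0 addr0.
(* The right-hand side moves 0 by exactly [k], so the rotation would move the preimage of 0 under
   [g] by an integer. *)
- case: e re ve fixd {gk} => // th _ ve fixd; exfalso.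
  apply: (kint _ k (rho01 _ ve)); have := fixd (lh_inv g 0) k.
  rewrite lh_invK base_repr0 // eqxx /= rhoE // => /eqP /=.
  by move/addrI.
- exfalso; case: e' re' ve' fixd {gk} => // th _ ve' fixd.
  apply: (kint _ (- k) (rho01 _ ve')); have := fixd 0 0.
  rewrite base_repr0 // addr0 eqxx /= rhoE //= addr0 => /esym/eqP.
  by rewrite mulrNz; lra.
(* The conjugate of [base_repr e] fixes [g 0], so [base_repr e'] moves [g 0] by [- k], which is less
   than 1 in absolute value. *)
have k0 : k = 0.
  have := fixd 0 0; rewrite base_repr0 // !addr0 eqxx => /esym/eqP gk0.
  have := disp_lt1 (g 0) (base_repr0 ve' nre'); rewrite ltr_norml => /andP[d1 d2].
  have : k < 1 by rewrite -(ltr_int R); lra.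
  have : -1 < k by rewrite -(ltr_int R) mulrN1z; lra.
  lia.
split=> //; have {}gk : (g * base_repr e * g^-1)%g = base_repr e'.
  by rewrite gk k0; apply: liftHomeoP => x; rewrite lh_mulE /= addr0.
have [P N] := base_sign ve nre; have [P' N'] := base_sign ve' nre'.
have {P P'} sP : (e = B_id R \/ e = B_u R) <-> (e' = B_id R \/ e' = B_u R).
  by rewrite -P -P' -gk; symmetry; exact: conj_disp_npos.
have {N N'} sN : (e = B_id R \/ e = B_uN R) <-> (e' = B_id R \/ e' = B_uN R).
  by rewrite -N -N' -gk; symmetry; exact: conj_disp_nneg.
case: e e' ve ve' nre nre' sP sN gk {fixd k0} => [|||l|th] [|||l'|th'] //= ve ve' _ _ sP sN gk;
  try by exfalso; intuition discriminate.
by rewrite (conj_a_lift_inj Sg ve ve' gk).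
Qed.

Lemma SL2t_class_conj g f : SL2t g -> SL2t_class (g * f * g^-1)%g = SL2t_class f.
Proof.
move=> Sg; apply/seteqP; split=> _ [h Sh <-].
  by exists (h * g)%g; [exact: SL2tM|rewrite invgM !mulgA].
exists (h * g^-1)%g; first by apply: SL2tM => //; exact: SL2tV.
by rewrite invgM invgK !mulgA !divgK.
Qed.

Lemma SL2t_class_refl f : SL2t_class f f.
Proof. by exists 1%g; [exact: SL2t1|rewrite mul1g invg1 mulg1]. Qed.

Lemma SL2t_transl_base k e : base_valid e -> SL2t (transl k%:~R * base_repr e)%g.
Proof.
move=> ve; apply/SL2tP; exists (base_mx e); first exact: det_base_mx.
exact/covers_translz/covers_base.
Qed.

End Distinct.

Theorem theorem4p3 (R : realType) :
  [/\ [set SL2t_class a | a in @SL2t R]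
        = [set SL2t_class (class_form_repr c) | c in [set c : class_form R | class_form_valid c]],
      (forall c d : class_form R, class_form_valid c -> class_form_valid d ->
         SL2t_class (class_form_repr c) = SL2t_class (class_form_repr d) -> c = d)
    & (forall (c : class_form R) (a : liftHomeo R), class_form_valid c ->
         SL2t_class (class_form_repr c) a -> ell_sharp a = class_form_sharp c)].
Proof.
split.
- apply/seteqP; split=> [_ [f Sf <-]|_ [c /shift_form_ex[k [e [ve ->]]] <-]].
    have [g [k [e [Sg ve gf]]]] := SL2t_conj_base Sf.
    exists (shift_form k e); first exact: shift_form_valid.
    by rewrite shift_form_repr -gf SL2t_class_conj.
  rewrite shift_form_repr.
  by exists (transl k%:~R * base_repr e)%g => //; exact: SL2t_transl_base.
- move=> c d /shift_form_ex[k [e [ve ->]]] /shift_form_ex[k' [e' [ve' ->]]].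
  rewrite !shift_form_repr => cE; have := SL2t_class_refl (transl k'%:~R * base_repr e')%g.
  rewrite -cE => -[g Sg gE].
  (* Integral translations are central, so the one on the left can be moved to the right-hand
     side. *)
  have : (g * base_repr e * g^-1)%g = (transl (k' - k)%:~R * base_repr e')%g.
    apply: liftHomeoP => x; have := congr1 (fun f : liftHomeo R => f x) gE.
    rewrite translzC mulgA -translzC !lh_mulE /= rmorphB => h.
    by rewrite addrA -h addrK.
  move=> /(conj_base_inj Sg ve ve')[/eqP + ->].
  by rewrite subr_eq0 => /eqP ->.
- move=> c f /shift_form_ex[k [e [ve ->]]]; rewrite shift_form_repr => -[g _ <-].
  exact: conj_base_sharp.
Qed.
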